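(* Let $d\ge -1$ be an integer and let $p\colon\mathcal{C}\to\mathcal{D}$ be a functor, where $\mathcal{C}$ is an $\infty$-category and $\mathcal{D}$ is a $d$-category. (1) If $p\colon\mathcal{C}\to\mathcal{D}$ is an inner fibration, then so is $h_d(p)\colon h_d(\mathcal{C})\to h_d(\mathcal{D})=\mathcal{D}$. (2) If in addition $f$ is a $p$-coCartesian morphism in $\mathcal{C}$, then $h_d(f)$ (the image of $f$ under $\theta_d\colon\mathcal{C}\to h_d\mathcal{C}$) is $h_d(p)$-coCartesian in $h_d\mathcal{C}$.
   Context: $\infty$-categories are quasi-categories; inner fibrations and coCartesian morphisms are as in Lurie's Higher Topos Theory. Relative homotopy: for simplicial sets $A\subseteq B$ and $D$, $B\rtimes_A D$ is the pushout of $A\leftarrow A\times D\to B\times D$ (projection and inclusion). For maps $f,g\colon B\to X$ with $f|_A=g|_A$, a homotopy relative to $A$ is an extension of the induced map $f\cup g\colon B\rtimes_A\partial\Delta^1\to X$ to $B\rtimes_A\Delta^1$. When $X$ is an $\infty$-category this is an equivalence relation. For $A\subseteq B\subseteq C$, $[A,B,C;X]$ is the set of maps $B\to X$ that admit an extension to $C$, modulo homotopy relative to $A$. A $d$-category ($d\ge -1$) is an $\infty$-category $\mathcal{D}$ such that (i) any two maps $f,f'\colon\Delta^d\to\mathcal{D}$ homotopic relative to $\partial\Delta^d$ are equal, and (ii) for every $m>d$, any two maps $f,f'\colon\Delta^m\to\mathcal{D}$ with $f|_{\partial\Delta^m}=f'|_{\partial\Delta^m}$ are equal. (Here $\Delta^{-1}=\varnothing$.)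 The $d$-homotopy category $h_d\mathcal{C}$ of an $\infty$-category $\mathcal{C}$, with canonical map $\theta_d\colon\mathcal{C}\to h_d\mathcal{C}$, is defined as follows ($K^j=\mathrm{sk}^jK$). - For $d\ge 1$: $h_d\mathcal{C}$ is the (essentially unique) simplicial set with bijections $\operatorname{Hom}(K,h_d\mathcal{C})\simeq[K^{d-1},K^d,K^{d+1};\mathcal{C}]$ natural in the simplicial set $K$; $\theta_d$ sends a map $K\to\mathcal{C}$ to the class of its restriction to $K^d$. - For $d=0$: let $\tilde h_0\mathcal{C}$ be the preordered set of objects of $\mathcal{C}$ with $x\le y$ iff $\operatorname{Map}_{\mathcal{C}}(x,y)\ne\varnothing$; $h_0\mathcal{C}$ is the nerve of the poset obtained by identifying isomorphic objects, and $\theta_0$ is the obvious map. - For $d=-1$: $h_{-1}\mathcal{C}=\varnothing$ if $\mathcal{C}=\varnothing$ and $\Delta^0$ otherwise. The construction $h_d$ is functorial, and for a $d$-category $\mathcal{D}$ the map $\theta_d\colon\mathcal{D}\to h_d\mathcal{D}$ is an isomorphism, through which $h_d\mathcal{D}$ is identified with $\mathcal{D}$. *)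

(* Defs.v *)
From HB Require Import structures.
From mathcomp Require Import all_boot all_order all_algebra.
From mathcomp Require Import boolp.

Set Implicit Arguments.
Unset Strict Implicit.
Unset Printing Implicit Defensive.

(** [smap m n] is the type of maps [m] -> [n] in the simplex category, the
    ordinal [n] being 'I_n.+1. *)

Definition monotone m n (f : {ffun 'I_m.+1 -> 'I_n.+1}) : bool :=
  [forall i : 'I_m.+1, forall j : 'I_m.+1, (i <= j) ==> (f i <= f j)].

Record smap (m n : nat) := SMap {
  smap_fun :> {ffun 'I_m.+1 -> 'I_n.+1};
  smap_mono : monotone smap_fun }.

HB.instance Definition _ m n := [isSub for @smap_fun m n].
HB.instance Definition _ m n := [Equality of smap m n by <:].

Lemma monotoneP m n (f : {ffun 'I_m.+1 -> 'I_n.+1}) :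
  reflect (forall i j : 'I_m.+1, i <= j -> f i <= f j) (monotone f).
Proof.
apply: (iffP forallP) => [H i j ij|H i].
  by have /forallP/(_ j)/implyP := H i; exact.
by apply/forallP => j; apply/implyP; exact: H.
Qed.

Lemma smapP m n (f g : smap m n) : (forall i, f i = g i) -> f = g.
Proof. by move=> fg; apply/val_inj/ffunP. Qed.

Lemma smap_le m n (f : smap m n) (i j : 'I_m.+1) : i <= j -> f i <= f j.
Proof. exact/monotoneP/smap_mono. Qed.

Lemma mk_smap_mono m n (f : 'I_m.+1 -> 'I_n.+1)
  (H : forall i j : 'I_m.+1, i <= j -> f i <= f j) : monotone (finfun f).
Proof. by apply/monotoneP => i j ij; rewrite !ffunE; exact: H. Qed.

Definition mk_smap m n (f : 'I_m.+1 -> 'I_n.+1)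
  (H : forall i j : 'I_m.+1, i <= j -> f i <= f j) : smap m n :=
  SMap (mk_smap_mono H).

Lemma mk_smapE m n f H i : @mk_smap m n f H i = f i.
Proof. exact: ffunE. Qed.

Definition smap_id n : smap n n := @mk_smap n n id (fun i j ij => ij).

Lemma smap_comp_subproof m n k (g : smap n k) (f : smap m n) (i j : 'I_m.+1) :
  i <= j -> g (f i) <= g (f j).
Proof. by move=> ij; do 2 apply: smap_le. Qed.

Definition smap_comp m n k (g : smap n k) (f : smap m n) : smap m k :=
  mk_smap (smap_comp_subproof g f).

Definition smap_const m n (c : 'I_n.+1) : smap m n :=
  @mk_smap m n (fun=> c) (fun i j _ => leqnn c).

Definition pair_fun n (i j : 'I_n.+1) (k : 'I_2) : 'I_n.+1 :=
  if k == ord0 then i else j.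

Lemma smap_pair_subproof n (i j : 'I_n.+1) (ij : i <= j) (k l : 'I_2) :
  k <= l -> pair_fun i j k <= pair_fun i j l.
Proof.
rewrite /pair_fun; case: eqP => [->|k0]; case: eqP => [->|l0] // kl.
by case: k0; apply/val_inj/eqP; rewrite -leqn0.
Qed.

Definition smap_pair n (i j : 'I_n.+1) (ij : i <= j) : smap 1 n :=
  mk_smap (smap_pair_subproof ij).

(** The ordinal join [m] * [n] is [m + n.+1]: its vertices form
    'I_(m.+1 + n.+1), the left summand coming first. *)

Definition join_fun m m' n n' (f : smap m m') (g : smap n n')
    (i : 'I_(m.+1 + n.+1)) : 'I_(m'.+1 + n'.+1) :=
  match split i with
  | inl a => lshift n'.+1 (f a)
  | inr b => rshift m'.+1 (g b)
  end.

Lemma smap_join_subproof m m' n n' (f : smap m m') (g : smap n n')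
    (i j : 'I_(m.+1 + n.+1)) : i <= j -> join_fun f g i <= join_fun f g j.
Proof.
rewrite /join_fun -{1}(splitK i) -{1}(splitK j).
case: (split i) => a; case: (split j) => b /= ab.
- exact: smap_le.
- by apply: ltnW; apply: leq_trans (ltn_ord _) _; exact: leq_addr.
- by move: ab; rewrite leqNgt ltn_addr.
- by rewrite leq_add2l; apply: smap_le; rewrite -(leq_add2l m.+1).
Qed.

Definition smap_join m m' n n' (f : smap m m') (g : smap n n') :
    smap (m + n.+1) (m' + n'.+1) :=
  @mk_smap (m + n.+1) (m' + n'.+1) (join_fun f g) (smap_join_subproof f g).

Definition smap_inl m n : smap m (m + n.+1) :=
  @mk_smap m (m + n.+1) (@lshift m.+1 n.+1) (fun i j ij => ij).

Record sset := SSet {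
  spx :> nat -> Type;
  act : forall m n, smap m n -> spx n -> spx m;
  act_id : forall n (x : spx n), act (smap_id n) x = x;
  act_comp : forall m n k (g : smap n k) (f : smap m n) (x : spx k),
    act (smap_comp g f) x = act f (act g x) }.

Arguments act {s m n}.

Record shom (X Y : sset) := SHom {
  app :> forall n, X n -> Y n;
  app_act : forall m n (f : smap m n) (x : X n), app (act f x) = act f (app x) }.

Arguments app {X Y} s {n} x.

Lemma shomP X Y (u v : shom X Y) : (forall n (x : X n), u n x = v n x) -> u = v.
Proof.
case: u v => [u Hu] [v Hv] /= uv.
have e : u = v by apply: functional_extensionality_dep => n; apply: funext.
by case: _ / e in Hv *; congr SHom; exact: Prop_irrelevance.
Qed.

Definition shom_id X : shom X X := @SHom X X (fun _ x => x) (fun _ _ _ _ => erefl).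

Lemma shom_comp_subproof X Y Z (v : shom Y Z) (u : shom X Y) m n (f : smap m n)
  (x : X n) : v m (u m (act f x)) = act f (v n (u n x)).
Proof. by rewrite !app_act. Qed.

Definition shom_comp X Y Z (v : shom Y Z) (u : shom X Y) : shom X Z :=
  SHom (shom_comp_subproof v u).

Record sset_iso (X Y : sset) := SSetIso {
  iso_fwd : shom X Y;
  iso_bwd : shom Y X;
  iso_bwdK : shom_comp iso_bwd iso_fwd = shom_id X;
  iso_fwdK : shom_comp iso_fwd iso_bwd = shom_id Y }.

Definition empty_sset : sset :=
  @SSet (fun=> void) (fun _ _ _ x => x) (fun _ _ => erefl)
        (fun _ _ _ _ _ _ => erefl).

Lemma Delta_act_id k n (x : smap n k) : smap_comp x (smap_id n) = x.
Proof. by apply: smapP => i; rewrite !mk_smapE. Qed.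

Lemma Delta_act_comp l m n k (g : smap n k) (f : smap m n) (x : smap k l) :
  smap_comp x (smap_comp g f) = smap_comp (smap_comp x g) f.
Proof. by apply: smapP => i; rewrite !mk_smapE. Qed.

Definition Delta (k : nat) : sset :=
  @SSet (fun n => smap n k) (fun _ _ f x => smap_comp x f)
        (@Delta_act_id k) (@Delta_act_comp k).

Lemma prodS_act_id (X Y : sset) n (x : X n * Y n) :
  (act (smap_id n) x.1, act (smap_id n) x.2) = x.
Proof. by rewrite !act_id; case: x. Qed.

Lemma prodS_act_comp (X Y : sset) m n k (g : smap n k) (f : smap m n)
    (x : X k * Y k) :
  (act (smap_comp g f) x.1, act (smap_comp g f) x.2)
  = (act f (act g x.1), act f (act g x.2)).
Proof. by rewrite !act_comp. Qed.

Definition prodS (X Y : sset) : sset :=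
  @SSet (fun n => (X n * Y n)%type)
        (fun _ _ f x => (act f x.1, act f x.2))
        (@prodS_act_id X Y) (@prodS_act_comp X Y).

Record subsset (X : sset) := SubSSet {
  smem : forall n, X n -> Prop;
  smem_act : forall m n (f : smap m n) (x : X n), smem x -> smem (act f x) }.

Arguments smem {X} s {n} x.

Lemma sig_inj (T : Type) (P : T -> Prop) (x y : {t | P t}) :
  sval x = sval y -> x = y.
Proof. by case: x y => x Px [y Py] /= exy; exact: eq_exist. Qed.

Definition sub_act X (A : subsset X) m n (f : smap m n) (x : {x : X n | smem A x}) :
    {x : X m | smem A x} :=
  exist _ (act f (sval x)) (smem_act f (svalP x)).

Lemma sub_act_id X (A : subsset X) n (x : {x : X n | smem A x}) :
  sub_act (smap_id n) x = x.
Proof. by apply: sig_inj; exact: act_id. Qed.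

Lemma sub_act_comp X (A : subsset X) m n k (g : smap n k) (f : smap m n)
  (x : {x : X k | smem A x}) : sub_act (smap_comp g f) x = sub_act f (sub_act g x).
Proof. by apply: sig_inj; exact: act_comp. Qed.

Definition sub_sset X (A : subsset X) : sset :=
  SSet (@sub_act_id X A) (@sub_act_comp X A).

Coercion sub_sset : subsset >-> sset.

Definition incl X (A : subsset X) : shom A X :=
  @SHom A X (fun n x => sval x) (fun _ _ _ _ => erefl).

(** The intersection of A and B, as a simplicial subset of B. *)
Definition sub_in X (A B : subsset X) : subsset B :=
  @SubSSet B (fun n x => smem A (sval x)) (fun m n f x => @smem_act X A m n f (sval x)).

Definition sub_map X Y (A : subsset X) (B : subsset Y) (u : shom X Y)
    (uAB : forall n (x : X n), smem A x -> smem B (u n x)) : shom A B.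
Proof.
exists (fun n x => exist _ (u n (sval x)) (uAB n _ (svalP x))) => m n f x.
by apply: sig_inj; exact: app_act.
Defined.

Definition bd (k : nat) : subsset (Delta k).
Proof.
exists (fun n (x : Delta k n) => exists j : 'I_k.+1, forall i, x i != j).
by move=> m n f x [j xj]; exists j => i; rewrite mk_smapE.
Defined.

Definition horn (k : nat) (l : 'I_k.+1) : subsset (Delta k).
Proof.
exists (fun n (x : Delta k n) =>
  exists2 j : 'I_k.+1, j != l & forall i, x i != j).
by move=> m n f x [j jl xj]; exists j => // i; rewrite mk_smapE.
Defined.

Definition sk (j : nat) (K : sset) : subsset K.
Proof.
exists (fun n (x : K n) =>
  exists m (f : smap n m) (y : K m), m <= j /\ x = act f y).
move=> m n f x [l [g [y [lj ->]]]].
by exists l, (smap_comp g f), y; rewrite act_comp.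
Defined.

Lemma sk_stable j K' K (k : shom K' K) n (x : K' n) :
  smem (sk j K') x -> smem (sk j K) (k n x).
Proof.
by move=> [m [f [y [mj ->]]]]; exists m, f, (k m y); rewrite app_act.
Qed.

Definition sk_map j K' K (k : shom K' K) : shom (sk j K') (sk j K) :=
  sub_map (@sk_stable j K' K k).

Definition has_rlp (B : sset) (A : subsset B) X Y (p : shom X Y) : Prop :=
  forall (u : shom A X) (v : shom B Y),
    shom_comp p u = shom_comp v (incl A) ->
    exists w : shom B X, shom_comp w (incl A) = u /\ shom_comp p w = v.

Definition infty_category (X : sset) : Prop :=
  forall n (i : 'I_n.+1), 0 < i < n ->
    forall u : shom (horn i) X,
      exists w : shom (Delta n) X, shom_comp w (incl (horn i)) = u.

Definition inner_fibration X Y (p : shom X Y) : Prop :=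
  forall n (i : 'I_n.+1), 0 < i < n -> has_rlp (horn i) p.

Definition trivial_fibration X Y (p : shom X Y) : Prop :=
  forall n, has_rlp (bd n) p.

(** [under s], for a simplex s : Delta^k -> X, is X_{s/}: its n-simplices are
    the maps Delta^k * Delta^n -> X restricting to s on Delta^k. *)

Definition under_spx (X : sset) k (s : X k) (n : nat) : Type :=
  {t : X (k + n.+1)%N | act (smap_inl k n) t = s}.

Lemma join_inl j k m n (d : smap j k) (f : smap m n) :
  smap_comp (smap_join d f) (smap_inl j m) = smap_comp (smap_inl k n) d.
Proof.
apply: smapP => i; rewrite !mk_smapE /join_fun.
by rewrite (unsplitK (inl _ i : 'I_j.+1 + 'I_m.+1)).
Qed.

Lemma join_id k n : smap_join (smap_id k) (smap_id n) = smap_id (k + n.+1).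
Proof.
apply: smapP => i; rewrite !mk_smapE /join_fun -[RHS](@splitK k.+1 n.+1).
by case: split => a; rewrite mk_smapE.
Qed.

Lemma join_comp k k' k'' m n l (d' : smap k' k'') (g : smap n l)
    (d : smap k k') (f : smap m n) :
  smap_join (smap_comp d' d) (smap_comp g f)
  = smap_comp (smap_join d' g) (smap_join d f).
Proof.
apply: smapP => i; rewrite !mk_smapE /join_fun.
case: (@split k.+1 m.+1 i) => a.
  by rewrite (unsplitK (inl _ (d a) : 'I_k'.+1 + 'I_n.+1)) mk_smapE.
by rewrite (unsplitK (inr _ (f a) : 'I_k'.+1 + 'I_n.+1)) mk_smapE.
Qed.

Lemma smap_comp_id m n (f : smap m n) : smap_comp (smap_id n) f = f.
Proof. by apply: smapP => i; rewrite !mk_smapE. Qed.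

Lemma under_act_subproof (X : sset) k (s : X k) m n (f : smap m n)
    (t : under_spx s n) :
  act (smap_inl k m) (act (smap_join (smap_id k) f) (sval t)) = s.
Proof. by rewrite -act_comp join_inl Delta_act_id (svalP t). Qed.

Definition under_act (X : sset) k (s : X k) m n (f : smap m n)
    (t : under_spx s n) : under_spx s m :=
  exist _ (act (smap_join (smap_id k) f) (sval t)) (under_act_subproof f t).

Lemma under_act_id (X : sset) k (s : X k) n (t : under_spx s n) :
  under_act (smap_id n) t = t.
Proof. by apply: sig_inj; rewrite /= join_id act_id. Qed.

Lemma under_act_comp (X : sset) k (s : X k) m n l (g : smap n l) (f : smap m n)
  (t : under_spx s l) : under_act (smap_comp g f) t = under_act f (under_act g t).
Proof.
by apply: sig_inj; rewrite /= -act_comp -join_comp smap_comp_id.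
Qed.

Definition under (X : sset) k (s : X k) : sset :=
  SSet (@under_act_id X k s) (@under_act_comp X k s).

Lemma under_map_subproof X Y (p : shom X Y) k (s : X k) (s' : Y k)
    (e : p k s = s') n (t : under s n) :
  act (smap_inl k n) (p _ (sval t)) = s'.
Proof. by rewrite -app_act (svalP t). Qed.

(** X_{s/} -> Y_{p s/} *)
Definition under_map X Y (p : shom X Y) k (s : X k) (s' : Y k)
    (e : p k s = s') : shom (under s) (under s').
Proof.
exists (fun n t => exist _ (p _ (sval t)) (under_map_subproof e t)).
by move=> m n f t; apply: sig_inj; exact: app_act.
Defined.

Lemma under_res_subproof (X : sset) j k (d : smap j k) (s : X k) (s' : X j)
    (e : act d s = s') n (t : under s n) :
  act (smap_inl j n) (act (smap_join d (smap_id n)) (sval t)) = s'.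
Proof. by rewrite -act_comp join_inl act_comp (svalP t). Qed.

(** X_{s/} -> X_{s d/} *)
Definition under_res (X : sset) j k (d : smap j k) (s : X k) (s' : X j)
    (e : act d s = s') : shom (under s) (under s').
Proof.
exists (fun n t => exist _ (act (smap_join d (smap_id n)) (sval t))
                           (under_res_subproof e t)).
move=> m n f t; apply: sig_inj; rewrite /= -!act_comp -!join_comp.
by rewrite !smap_comp_id !Delta_act_id.
Defined.

Definition fiber_prod X Y Z (u : shom X Z) (v : shom Y Z) : subsset (prodS X Y).
Proof.
exists (fun n (x : prodS X Y n) => u n x.1 = v n x.2).
by move=> m n f x /= e; rewrite !app_act e.
Defined.

Definition fiber_pair W X Y Z (u : shom X Z) (v : shom Y Z)
    (a : shom W X) (b : shom W Y) (e : shom_comp u a = shom_comp v b) :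
  shom W (fiber_prod u v).
Proof.
exists (fun n w => exist (fun x : prodS X Y n => u n x.1 = v n x.2)
  (a n w, b n w) (congr1 (fun h : shom W Z => h n w) e)).
by move=> m n f w; apply: sig_inj; rewrite /= !app_act.
Defined.

Definition vertex n (i : 'I_n.+1) : smap 0 n := smap_const 0 i.

Definition src (X : sset) (f : X 1) : X 0 := act (vertex (ord0 : 'I_2)) f.
Definition tgt (X : sset) (f : X 1) : X 0 := act (vertex (ord_max : 'I_2)) f.

Lemma src_nat X Y (p : shom X Y) (f : X 1) : src (p 1 f) = p 0 (src f).
Proof. by rewrite /src app_act. Qed.

Lemma cocart_square X Y (p : shom X Y) (f : X 1) :
  shom_comp (under_map (erefl (p 0 (src f)))) (under_res (erefl (src f)))
  = shom_comp (under_res (src_nat p f)) (under_map (erefl (p 1 f))).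
Proof. by apply: shomP => n t; apply: sig_inj; exact: app_act. Qed.

(** X_{f/} -> X_{x/} x_{Y_{p x/}} Y_{p f/}, where x is the source of f *)
Definition cocart_cmp X Y (p : shom X Y) (f : X 1) :
  shom (under f)
      (fiber_prod (under_map (erefl (p 0 (src f)))) (under_res (src_nat p f))) :=
  fiber_pair (cocart_square p f).

(** The notion is meant for an inner fibration p. *)
Definition cocartesian X Y (p : shom X Y) (f : X 1) : Prop :=
  trivial_fibration (cocart_cmp p f).

(** By the universal property of the pushout defining the relative cylinder of
    (B, A), a map from it to X is a map B x Delta^1 -> X whose restriction to
    A x Delta^1 factors through the projection to A. *)
Definition rel_homotopy (B : sset) (A : subsset B) X (f g : shom B X)
    (h : shom (prodS B (Delta 1)) X) : Prop :=
  [/\ forall n (b : B n), h n (b, smap_const n ord0) = f n b,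
      forall n (b : B n), h n (b, smap_const n ord_max) = g n b
    & forall n (b : B n) (t : Delta 1 n), smem A b -> h n (b, t) = f n b].

(** When X is an infinity-category and A contains the vertices of B, the
    existence of a homotopy is already a symmetric relation.  In the remaining
    case of interest, A empty and B = Delta^0, a homotopy is just an edge;
    asking for homotopies in both directions makes a 0-category the nerve of an
    arbitrary poset rather than of a discrete one. *)
Definition homotopic (B : sset) (A : subsset B) X (f g : shom B X) : Prop :=
  (exists h, rel_homotopy A f g h) /\ (exists h, rel_homotopy A g f h).

Definition extends_to K (B C : subsset K) X (f : shom B X) : Prop :=
  exists F : shom C X, forall n (x : K n) (xB : smem B x) (xC : smem C x),
    F n (exist _ x xC) = f n (exist _ x xB).

(** Representatives of the elements of [A, B, C; X]; two of them have the same
    class when they are related by [homotopic (sub_in A B)]. *)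
Definition ext_maps K (B C : subsset K) X : Type := {f : shom B X | extends_to C f}.

Definition DeltaZ (d : int) : sset :=
  match d with Posz n => Delta n | Negz _ => empty_sset end.

Definition bdZ (d : int) : subsset (DeltaZ d) :=
  match d return subsset (DeltaZ d) with
  | Posz n => bd n
  | Negz _ => @SubSSet empty_sset (fun _ _ => False) (fun _ _ _ _ H => H)
  end.

Definition d_category (d : int) (D : sset) : Prop :=
  [/\ infty_category D,
      forall f f' : shom (DeltaZ d) D, homotopic (bdZ d) f f' -> f = f'
    & forall m : nat, (d < m%:Z)%R -> forall f f' : shom (Delta m) D,
        shom_comp f (incl (bd m)) = shom_comp f' (incl (bd m)) -> f = f'].

Notation hmaps e K X := (@ext_maps K (sk e.+1 K) (sk e.+2 K) X).

Definition hmaps_res e K X (f : shom K X) : hmaps e K X.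
Proof.
by exists (shom_comp f (incl (sk e.+1 K))); exists (shom_comp f (incl (sk e.+2 K))).
Defined.

Definition hmaps_pre e K' K X (k : shom K' K) (g : hmaps e K X) : hmaps e K' X.
Proof.
exists (shom_comp (sval g) (sk_map e.+1 k)).
have [F FE] := svalP g; exists (shom_comp F (sk_map e.+2 k)) => n x xB xC.
exact: FE.
Defined.

Definition hmaps_post e K X Y (p : shom X Y) (g : hmaps e K X) : hmaps e K Y.
Proof.
exists (shom_comp p (sval g)).
have [F FE] := svalP g; exists (shom_comp p F) => n x xB xC.
by congr (p n _); exact: FE.
Defined.

(** For d = e.+1: bijections [sk^e K, sk^(e+1) K, sk^(e+2) K; C] -> Hom(K, H), natural in K,
    presented by their values on representatives. *)
Record hrep (e : nat) (C H : sset) := HRep {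
  hcl : forall K : sset, hmaps e K C -> shom K H;
  hcl_eq : forall K (g g' : hmaps e K C),
    hcl g = hcl g' <->
    homotopic (sub_in (sk e K) (sk e.+1 K)) (sval g) (sval g');
  hcl_surj : forall K (u : shom K H), exists g : hmaps e K C, hcl g = u;
  hcl_nat : forall K' K (k : shom K' K) (g : hmaps e K C),
    shom_comp (hcl g) k = hcl (hmaps_pre k g) }.

(** Map_C(x, y) is nonempty iff there is an edge from x to y. *)
Definition obj_le (C : sset) (x y : C 0) : Prop :=
  exists f : C 1, src f = x /\ tgt f = y.

Definition obj_iso (C : sset) (x y : C 0) : Prop := obj_le x y /\ obj_le y x.

Definition iso_class (C : sset) : Type :=
  {S : C 0 -> Prop | exists x : C 0, S = obj_iso x}.

Definition cls (C : sset) (x : C 0) : iso_class C :=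
  exist _ (obj_iso x) (ex_intro _ x erefl).

Definition iso_class_le (C : sset) (S T : iso_class C) : Prop :=
  exists x y : C 0, [/\ sval S x, sval T y & obj_le x y].

Definition nerve_spx (P : Type) (R : P -> P -> Prop) (n : nat) : Type :=
  {s : 'I_n.+1 -> P | forall i j : 'I_n.+1, i <= j -> R (s i) (s j)}.

Definition nerve_act P (R : P -> P -> Prop) m n (f : smap m n)
    (s : nerve_spx R n) : nerve_spx R m.
Proof.
exists (fun i => sval s (f i)) => i j ij.
exact: (svalP s _ _ (smap_le f ij)).
Defined.

Lemma nerve_act_id P (R : P -> P -> Prop) n (s : nerve_spx R n) :
  nerve_act (smap_id n) s = s.
Proof.
by apply: sig_inj => /=; apply: functional_extensionality_dep => i; rewrite ffunE.
Qed.

Lemma nerve_act_comp P (R : P -> P -> Prop) m n k (g : smap n k) (f : smap m n)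
    (s : nerve_spx R k) :
  nerve_act (smap_comp g f) s = nerve_act f (nerve_act g s).
Proof.
by apply: sig_inj => /=; apply: functional_extensionality_dep => i; rewrite ffunE.
Qed.

Definition nerve (P : Type) (R : P -> P -> Prop) : sset :=
  SSet (@nerve_act_id P R) (@nerve_act_comp P R).

Definition h0 (C : sset) : sset := nerve (@iso_class_le C).

Lemma obj_iso_refl (C : sset) (x : C 0) : obj_iso x x.
Proof.
suff H : obj_le x x by split.
exists (act (smap_const 1 (ord0 : 'I_1)) x).
rewrite /src /tgt -!act_comp; split; rewrite -[RHS]act_id; congr act;
  by apply: smapP => i; rewrite [LHS]ord1 [RHS]ord1.
Qed.

Lemma to_h0_subproof (C : sset) n (x : C n) (i j : 'I_n.+1) : i <= j ->
  iso_class_le (cls (act (vertex i) x)) (cls (act (vertex j) x)).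
Proof.
move=> ij; exists (act (vertex i) x), (act (vertex j) x); split;
  [exact: obj_iso_refl | exact: obj_iso_refl |].
exists (act (smap_pair ij) x); rewrite /src /tgt -!act_comp; split;
  by congr act; apply: smapP => k; rewrite !mk_smapE.
Qed.

Definition to_h0_app (C : sset) n (x : C n) : h0 C n :=
  exist (fun s : 'I_n.+1 -> iso_class C =>
           forall i j : 'I_n.+1, i <= j -> iso_class_le (s i) (s j))
    (fun i => cls (act (vertex i) x)) (to_h0_subproof x).

Lemma to_h0_act (C : sset) m n (f : smap m n) (x : C n) :
  to_h0_app (act f x) = act f (to_h0_app x).
Proof.
apply: sig_inj => /=; apply: functional_extensionality_dep => i; congr cls.
by rewrite -act_comp; congr act; apply: smapP => k; rewrite !mk_smapE.
Qed.

Definition to_h0 (C : sset) : shom C (h0 C) := SHom (@to_h0_act C).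

(** Delta^0 if C is nonempty, and empty otherwise. *)
Definition hm1 (C : sset) : subsset (Delta 0) :=
  @SubSSet (Delta 0) (fun _ _ => exists n, inhabited (C n)) (fun _ _ _ _ H => H).

Definition to_hm1 (C : sset) : shom C (hm1 C).
Proof.
exists (fun n x => exist (fun=> exists n, inhabited (C n))
  (smap_const n ord0 : Delta 0 n) (ex_intro _ n (inhabits x))).
by move=> m n f x; apply: sig_inj; apply: smapP => i; rewrite !mk_smapE.
Defined.

(** The data exhibiting H as h_d C; every negative d is treated as -1.  Such an
    H is unique up to a unique isomorphism compatible with the data. *)
Definition hcat_data (d : int) (C H : sset) : Type :=
  match d with
  | Posz e.+1 => hrep e C H
  | Posz 0 => sset_iso (h0 C) H
  | Negz _ => sset_iso (hm1 C) H
  end.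

Record hcat (d : int) (C : sset) := HCat {
  hobj :> sset;
  hdata : hcat_data d C hobj }.

(** For d = e.+1 and any f : K -> C, naturality of [hcl] shows that
    [shom_comp theta f] is the class of [hmaps_res e f]. *)
Definition theta_data (d : int) (C H : sset) : hcat_data d C H -> shom C H :=
  match d return hcat_data d C H -> shom C H with
  | Posz e.+1 => fun r => hcl r (hmaps_res e (shom_id C))
  | Posz 0 => fun r => shom_comp (iso_fwd r) (to_h0 C)
  | Negz _ => fun r => shom_comp (iso_fwd r) (to_hm1 C)
  end.

Definition theta (d : int) (C : sset) (HC : hcat d C) : shom C HC :=
  theta_data (hdata HC).

(** q is the map h_d(p).  For d >= 1, it corresponds to postcomposition with p
    on the represented functors; for d <= 0, it sends the class of x to the
    class of p x. *)
Definition is_hmap_data (d : int) (C D : sset) (p : shom C D) (H H' : sset) :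
    hcat_data d C H -> hcat_data d D H' -> shom H H' -> Prop :=
  match d return hcat_data d C H -> hcat_data d D H' -> shom H H' -> Prop with
  | Posz e.+1 => fun r r' q => forall K (g : hmaps e K C),
      shom_comp q (hcl r g) = hcl r' (hmaps_post p g)
  | Posz 0 => fun r r' q =>
      shom_comp q (@theta_data 0%Z C H r) = shom_comp (@theta_data 0%Z D H' r') p
  | Negz n => fun r r' q =>
      shom_comp q (@theta_data (Negz n) C H r)
      = shom_comp (@theta_data (Negz n) D H' r') p
  end.

Definition is_hmap (d : int) (C D : sset) (p : shom C D)
    (HC : hcat d C) (HD : hcat d D) (q : shom HC HD) : Prop :=
  is_hmap_data p (hdata HC) (hdata HD) q.

(* Main.v *)
Require Import Defs.
From mathcomp Require Import all_boot all_order all_algebra.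
From mathcomp Require Import boolp zify.

Set Implicit Arguments.
Unset Strict Implicit.
Unset Printing Implicit Defensive.

(** The functor [h_d p] is tested against horns, and a lifting problem against
    it is transported along [theta] to a lifting problem against [p].

    Let d = e.+1.  A map K -> h_d C is represented by a map sk^(e+1) K -> C that
    extends to sk^(e+2) K.  If n > e + 3, every simplex of dimension at most
    e + 2 of Delta^n lies in any given horn, so maps from the horn to h_d C
    extend uniquely to Delta^n and the lifting problem has a solution for formal
    reasons ([hrep_horn_large]).  If n <= e + 3, the horn has dimension at most
    e + 2, hence its maps to h_d C are of the form [theta] o g with g a map to C
    ([theta_hrep_horn_lift]).  For a d-category D the map [theta] : D -> h_d D
    is injective, and simplices of dimension at most e + 3 lift along it
    ([theta_hrep_inj], [theta_hrep_Delta_lift]).  So the whole square lifts to a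
    square over [p]; a diagonal of the latter gives one of the former.

    An edge f is coCartesian exactly when lifts exist against the left outer
    horns of Delta^(n+2) whose edge 01 is sent to f ([cocart_lift_cocart],
    [cocart_cocart_lift]).  The previous argument then applies as soon as the
    lift g of the horn can be chosen to send 01 to f itself.  For d > 1 this is
    automatic because [theta] is injective on edges.  For d = 1 the edge g(01)
    is merely homotopic to f; only horns of dimension at most 2 occur, and the
    triangles on that edge are replaced one at a time ([triangle_replace],
    [edge_replace]).

    For d = 0 the targets are nerves of transitive relations, where a map is
    determined by its vertices, and a horn extends as soon as the relation holds
    between its vertices.  For inner horns this is transitivity.  Left outer
    horns contain all the edges needed except for the edge 12 of Delta^2: there
    the triangle exists in D, because a 0-category has at most one edge between
    two objects, and the coCartesian edge lifts it to C ([h0_cocart_lift]).  For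
    d = -1 the targets have at most one simplex in each dimension. *)

(** * Simplices and faces *)

Lemma smap_natP m n (f g : smap m n) : (forall i, f i = g i :> nat) -> f = g.
Proof. by move=> fg; apply: smapP => i; apply: ord_inj. Qed.

Lemma smap_compE m n k (g : smap n k) (f : smap m n) i :
  smap_comp g f i = g (f i).
Proof. exact: mk_smapE. Qed.

Lemma shom_compA W X Y Z (w : shom Y Z) (v : shom X Y) (u : shom W X) :
  shom_comp w (shom_comp v u) = shom_comp (shom_comp w v) u.
Proof. exact: shomP. Qed.

Lemma shom_comp_idl X Y (u : shom X Y) : shom_comp (shom_id Y) u = u.
Proof. exact: shomP. Qed.

Definition simplex_map (X : sset) n (x : X n) : shom (Delta n) X :=
  @SHom (Delta n) X (fun m f => act f x)
    (fun m k f g => act_comp (s := X) g f x).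

Lemma simplex_map_id (X : sset) n (x : X n) : simplex_map x n (smap_id n) = x.
Proof. exact: act_id. Qed.

Lemma simplex_map_inj (X : sset) n : injective (@simplex_map X n).
Proof. by move=> x y xy; rewrite -(simplex_map_id x) xy simplex_map_id. Qed.

Lemma shom_simplexE (X : sset) n (u : shom (Delta n) X) m (f : smap m n) :
  u m f = act f (u n (smap_id n)).
Proof. by rewrite -app_act /= smap_comp_id. Qed.

Lemma simplex_map_eta (X : sset) n (u : shom (Delta n) X) :
  simplex_map (u n (smap_id n)) = u.
Proof. by apply: shomP => m f; rewrite [RHS]shom_simplexE. Qed.

Lemma shom_Delta_ext (X : sset) n (u v : shom (Delta n) X) :
  u n (smap_id n) = v n (smap_id n) -> u = v.
Proof. by move=> uv; rewrite -(simplex_map_eta u) -(simplex_map_eta v) uv. Qed.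

(** Injectivity of [e] makes it reflect the order, so the pointwise lift is
    automatically monotone. *)
Lemma smap_factor m k n (e : smap k n) (y : smap m n) : injective e ->
  (forall i, exists i', y i = e i') -> exists y' : smap m k, y = smap_comp e y'.
Proof.
move=> e_inj ye.
pose g i : 'I_k.+1 := odflt ord0 [pick i' | y i == e i'].
have gE i : y i = e (g i).
  rewrite /g; case: pickP => [i' /eqP //|no].
  by have [i' yi] := ye i; have := no i'; rewrite yi eqxx.
have g_mono (i j : 'I_m.+1) : i <= j -> g i <= g j.
  move=> ij; rewrite leqNgt; apply/negP => gji.
  have := smap_le y ij; rewrite !gE => le1.
  have eij : e (g j) = e (g i).
    by apply/val_inj/eqP; rewrite eqn_leq le1 smap_le // ltnW.
  by move: gji; rewrite (e_inj _ _ eij) ltnn.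
by exists (mk_smap g_mono); apply: smapP => i; rewrite smap_compE mk_smapE.
Qed.

Lemma face_subproof n (j : nat) (i : 'I_n.+1) : bump j i < n.+2.
Proof. by have := ltn_ord i; rewrite /bump; lia. Qed.

Definition face_fun n j (i : 'I_n.+1) : 'I_n.+2 := Ordinal (face_subproof j i).

Lemma face_mono n j (i i' : 'I_n.+1) : i <= i' -> face_fun j i <= face_fun j i'.
Proof. by rewrite leq_bump2. Qed.

(** The index is a natural number, unbounded, so that the cosimplicial
    identities and families of faces need no casts between ordinals. *)
Definition face n j : smap n n.+1 := mk_smap (@face_mono n j).

Lemma faceE n j i : face n j i = bump j i :> nat.
Proof. by rewrite mk_smapE. Qed.

Lemma face_inj n j : injective (face n j).
Proof.
by move=> a b /(congr1 val); rewrite /= !faceE => /(can_inj (@bumpK j)) /val_inj.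
Qed.

Lemma face_miss n j i : face n j i != j :> nat.
Proof. by rewrite faceE eq_sym neq_bump. Qed.

Lemma face_factor m n (y : smap m n.+1) (j : nat) : j <= n.+1 ->
  (forall i, y i != j :> nat) -> exists y', y = smap_comp (face n j) y'.
Proof.
move=> jn yj; apply: smap_factor; first exact: face_inj.
move=> i; have b : unbump j (y i) < n.+1.
  by have := ltn_ord (y i); have := yj i; rewrite /unbump; lia.
exists (Ordinal b); apply: ord_inj.
by rewrite faceE unbumpKcond (negbTE (yj i)).
Qed.

Lemma face_face n a b : a <= b ->
  smap_comp (face n.+1 b.+1) (face n a) = smap_comp (face n.+1 a) (face n b).
Proof.
move=> ab; apply: smap_natP => i.
by rewrite !smap_compE !faceE /bump; lia.
Qed.

Lemma face_faceA (X : sset) n (w : X n.+2) a b : a <= b ->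
  act (face n a) (act (face n.+1 b.+1) w) = act (face n b) (act (face n.+1 a) w).
Proof. by move=> ab; rewrite -!act_comp face_face. Qed.

(** * Maps out of a simplicial subset, by generators *)

Section Glue.
Variables (K : sset) (A : subsset K) (I : Type) (k : I -> nat).
Variable (e : forall i, K (k i)).
Hypothesis e_in : forall i, smem A (e i).
Hypothesis cover : forall m (y : K m), smem A y ->
  exists i (a : smap m (k i)), y = act a (e i).

Lemma shom_gen_ext (X : sset) (u v : shom A X) :
  (forall i, u _ (exist _ (e i) (e_in i)) = v _ (exist _ (e i) (e_in i))) -> u = v.
Proof.
move=> uv; apply: shomP => m [y yA].
have [i [a ya]] := cover yA.
have -> : exist _ y yA = act a (exist _ (e i) (e_in i) : A _) by apply: sig_inj.
by rewrite !app_act uv.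
Qed.

(** The compatibility condition tests all coincidences between simplices of the
    generators, degenerate or not, so that the value at a simplex does not depend
    on the chosen presentation. *)
Lemma shom_glue (X : sset) (x : forall i, X (k i)) :
  (forall i i' m (a : smap m (k i)) (a' : smap m (k i')),
     act a (e i) = act a' (e i') -> act a (x i) = act a' (x i')) ->
  exists u : shom A X, forall i, u _ (exist _ (e i) (e_in i)) = x i.
Proof.
move=> compat.
have pick m (y : A m) :
    {z : {i & smap m (k i)} | sval y = act (projT2 z) (e (projT1 z))}.
  apply: cid; have [i [a ya]] := cover (svalP y).
  by exists (existT _ i a).
pose g m (y : A m) : X m :=
  act (projT2 (sval (pick m y))) (x (projT1 (sval (pick m y)))).
have gE m (y : A m) i (a : smap m (k i)) : sval y = act a (e i) -> g m y = act a (x i).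
  by move=> ya; apply: compat; rewrite -ya; exact: esym (svalP (pick m y)).
have g_act m n (f : smap m n) (y : A n) : g m (act f y) = act f (g n y).
  rewrite -act_comp; apply: gE; rewrite act_comp; congr (act f _).
  exact: svalP (pick n y).
exists (SHom g_act) => i /=; rewrite -[RHS]act_id; apply: gE.
by rewrite act_id.
Qed.

End Glue.

Section GlueHorn.
Variables (n : nat) (l : 'I_n.+2).

Let J := {j : 'I_n.+2 | j != l}.

Lemma face_in_horn (j : 'I_n.+2) : j != l -> smem (horn l) (face n j : Delta _ _).
Proof. by exists j => // i; exact: face_miss. Qed.

Lemma horn_cover m (y : Delta n.+1 m) : smem (horn l) y ->
  exists (j : J) (a : smap m n), y = act a (face n (sval j) : Delta _ _).
Proof.
move=> [j jl yj]; have [||y' ->] := @face_factor m n y j; first exact: leq_ord.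
  exact: yj.
by exists (exist _ j jl), y'.
Qed.

Lemma horn_ext (X : sset) (u v : shom (horn l) X) :
  (forall (j : nat) (h : smem (horn l) (face n j : Delta n.+1 n)),
      j <= n.+1 -> j != l -> u n (exist _ _ h) = v n (exist _ _ h)) -> u = v.
Proof.
move=> uv; apply: (shom_gen_ext (e := fun j : J => face n (sval j) : Delta _ _)
  (e_in := fun j : J => face_in_horn (svalP j)) horn_cover) => j.
by apply: uv; [exact: leq_ord | exact: (svalP j)].
Qed.

End GlueHorn.

(** Two distinct faces i < i' of a simplex meet in a common face of codimension
    two, so the classical identities between codimension-two faces give
    compatibility on all common simplices. *)
Lemma horn_glue n (l : 'I_n.+3) (X : sset) (x : nat -> X n.+1) :
  (forall a b, a <= b -> b <= n.+1 -> a != l -> b.+1 != l ->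
     act (face n a) (x b.+1) = act (face n b) (x a)) ->
  exists u : shom (horn l) X,
    forall (j : nat) (h : smem (horn l) (face n.+1 j : Delta n.+2 n.+1)),
      j <= n.+2 -> j != l -> u _ (exist _ _ h) = x j.
Proof.
move=> xx.
have compat m (i i' : {j : 'I_n.+3 | j != l}) (a a' : smap m n.+1) :
    sval i <= sval i' ->
    smap_comp (face _ (sval i)) a = smap_comp (face _ (sval i')) a' ->
    act a (x (sval i)) = act a' (x (sval i')).
  case: i i' => [i il] [i' il'] /=; rewrite leq_eqVlt => /orP[/eqP/val_inj <-|ii'] aa'.
    congr act; apply: smapP => s; apply: (@face_inj _ i).
    by rewrite -!smap_compE aa'.
  (* a common simplex of the faces i < i' factors through face i'-1 of face i *)
  have [] := @face_factor _ _ a i'.-1 _ _; first by have := ltn_ord i'; lia.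
    move=> s; apply/eqP => as'.
    have := face_miss i' (a' s); rewrite -smap_compE -aa' smap_compE faceE as'.
    by rewrite /bump; lia.
  move=> c ac.
  have -> : a' = smap_comp (face _ i) c.
    apply: smapP => s; apply: (@face_inj _ i').
    rewrite -!smap_compE -aa' ac; apply: ord_inj.
    by rewrite !smap_compE !faceE /bump; lia.
  have ei : i' = i'.-1.+1 :> nat by lia.
  rewrite ac !act_comp ei xx //; [by lia | by have := ltn_ord i'; lia |].
  by rewrite -ei.
have [|u uE] := shom_glue
    (e := fun j : {j : 'I_n.+3 | j != l} => face _ (sval j) : Delta _ _)
    (fun j : {j : 'I_n.+3 | j != l} => face_in_horn (svalP j)) (@horn_cover _ l)
    (x := fun j => x (sval j)).
  move=> i i' m a a' aa'; case/orP: (leq_total (sval i) (sval i')) => ii'.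
    exact: compat.
  by apply/esym/compat.
exists u => j h jn jl; rewrite -(uE (exist _ (Ordinal (jn : j < n.+3)) jl)).
by congr (u _ _); exact: sig_inj.
Qed.

(** * Joins *)

Lemma inlE m n i : smap_inl m n i = i :> nat.
Proof. by rewrite mk_smapE. Qed.

Lemma smap_inl_inj m n : injective (smap_inl m n).
Proof. by move=> i j /(congr1 (@nat_of_ord _)); rewrite !inlE; exact: ord_inj. Qed.

Lemma joinE m m' n n' (f : smap m m') (g : smap n n') (i : 'I_(m + n.+1).+1) :
  smap_join f g i =
    (if i < m.+1 then f (inord i) : nat else m'.+1 + g (inord (i - m.+1))) :> nat.
Proof.
rewrite mk_smapE /join_fun; case: (@splitP m.+1 n.+1 i) => k ik /=.
  by rewrite ik inord_val.
by rewrite ik addKn inord_val.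
Qed.

Lemma join_inlE m m' n n' (f : smap m m') (g : smap n n') (i : 'I_(m + n.+1).+1) 
  (k : 'I_m.+1) : i = k :> nat -> smap_join f g i = f k :> nat.
Proof. by move=> ik; rewrite joinE ik ltn_ord inord_val. Qed.

Lemma join_inrE m m' n n' (f : smap m m') (g : smap n n') (i : 'I_(m + n.+1).+1) 
  (k : 'I_n.+1) : i = m.+1 + k :> nat -> smap_join f g i = m'.+1 + g k :> nat.
Proof. by move=> ik; rewrite joinE ik ltnNge leq_addr addKn inord_val. Qed.

Lemma join_lt j n n' (g : smap n n') (i : 'I_(j + n.+1).+1) :
  (smap_join (smap_id j) g i < j.+1) = (i < j.+1).
Proof.
rewrite joinE; case: (ltnP i j.+1) => ij; last by rewrite ltnNge leq_addr.
by rewrite mk_smapE ltn_ord.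
Qed.

(** A simplex b of [j] * [n] that meets the right summand factors as
    (id * r) o c, where c keeps the vertices of b on the left and sends a vertex
    i on the right to i itself.  Thus c depends only on which vertices lie on
    the right, and is the same for b and b'.  This is what allows maps defined
    on joins with faces to be compared without restricting to nondegenerate
    simplices. *)
Lemma join_dec j n n' m k (z : smap n n') (z' : smap k n')
    (b : smap m (j + n.+1)) (b' : smap m (j + k.+1)) :
  smap_comp (smap_join (smap_id j) z) b = smap_comp (smap_join (smap_id j) z') b' ->
  (exists y, b = smap_comp (smap_inl j n) y /\ b' = smap_comp (smap_inl j k) y) \/
  exists (c : smap m (j + m.+1)) r r',
    [/\ b = smap_comp (smap_join (smap_id j) r) c,
        b' = smap_comp (smap_join (smap_id j) r') c
      & smap_comp z r = smap_comp z' r'].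
Proof.
move=> bb'.
have bbi (i : 'I_m.+1) :
    smap_join (smap_id j) z (b i) = smap_join (smap_id j) z' (b' i).
  by rewrite -!smap_compE bb'.
have lt (i : 'I_m.+1) : (b i < j.+1) = (b' i < j.+1).
  by rewrite -(join_lt z) bbi join_lt.
have eql (i : 'I_m.+1) : b i < j.+1 -> b' i = b i :> nat.
  move=> bi; have b'i := bi; rewrite lt in b'i.
  have := congr1 (@nat_of_ord _) (bbi i); rewrite !joinE bi b'i !mk_smapE.
  by rewrite !inordK.
case: (ltnP (b (ord_max : 'I_m.+1)) j.+1) => bm; [left|right].
  have bl i : b i < j.+1 by apply: leq_ltn_trans bm; apply: smap_le; exact: leq_ord.
  have [||y yb] := @smap_factor m j _ (smap_inl j n) b; first exact: smap_inl_inj.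
    by move=> i; exists (Ordinal (bl i)); apply: ord_inj; rewrite inlE.
  exists y; split=> //; apply: smap_natP => i.
  by rewrite eql // yb !smap_compE !inlE.
(* i0 is the first vertex on the right; r must be defined on all of [m], so it
   is evaluated at max(i, i0), which changes nothing on the right vertices. *)
have [i0 [bi0 i0_min]] : exists i0 : 'I_m.+1,
    j < b i0 /\ forall i : 'I_m.+1, j < b i -> i0 <= i.
  case: (@arg_minnP 'I_m.+1 ord_max (fun i => j < b i) (fun i => i) bm) => i0.
  by exists i0.
have i0_le (i : 'I_m.+1) : (i0 <= i) = (j < b i).
  apply/idP/idP => [i0i|]; last exact: i0_min.
  by apply: leq_trans bi0 _; exact: smap_le.
pose mx (i : 'I_m.+1) := if i <= i0 then i0 else i.
have mxE (i : 'I_m.+1) : mx i = maxn i i0 :> nat.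
  by rewrite /mx; case: ifP; lia.
have mx_ge (i : 'I_m.+1) : j < b (mx i) by rewrite -i0_le mxE; lia.
have mx_mono (a c : 'I_m.+1) : a <= c -> mx a <= mx c by rewrite !mxE; lia.
have mx_id (i : 'I_m.+1) : j < b i -> mx i = i.
  rewrite -i0_le => i0i; apply: ord_inj; rewrite mxE; lia.
have mono q (d : smap m (j + q.+1)) (dge : forall i, j < d (mx i)) (a c : 'I_m.+1) :
    a <= c ->
    (inord (d (mx a) - j.+1) : 'I_q.+1) <= (inord (d (mx c) - j.+1) : 'I_q.+1).
  move=> ac; have H i : d i - j.+1 < q.+1 by have := ltn_ord (d i); lia.
  by rewrite !inordK // leq_sub2r // smap_le // mx_mono.
have mx_ge' i : j < b' (mx i) by have := lt (mx i); have := mx_ge i; lia.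
pose cf (i : 'I_m.+1) : 'I_(j + m.+1).+1 :=
  inord (if b i < j.+1 then b i : nat else j.+1 + i).
have cfE i : cf i = (if b i < j.+1 then b i : nat else j.+1 + i) :> nat.
  by rewrite inordK //; have := ltn_ord i; case: ifP; lia.
have c_mono (a c : 'I_m.+1) : a <= c -> cf a <= cf c.
  by move=> ac; rewrite !cfE; have := smap_le b ac; do 2 case: ifP; lia.
have fact q (d : smap m (j + q.+1)) (dge : forall i, j < d (mx i)) :
    (forall i, (b i < j.+1) = (d i < j.+1)) ->
    (forall i, b i < j.+1 -> d i = b i :> nat) ->
    d = smap_comp (smap_join (smap_id j) (mk_smap (mono _ _ dge))) (mk_smap c_mono).
  move=> lt_d eq_d; apply: smap_natP => i; rewrite smap_compE mk_smapE.
  have := cfE i; case: ifP => bi ci.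
    by rewrite (@join_inlE _ _ _ _ _ _ _ (Ordinal bi)) // mk_smapE /= eq_d.
  rewrite (@join_inrE _ _ _ _ _ _ _ i) // mk_smapE.
  have -> : mx i = i by apply: mx_id; lia.
  rewrite inordK; first by have := lt_d i; lia.
  by have := ltn_ord (d i); lia.
exists (mk_smap c_mono), (mk_smap (mono _ _ mx_ge)), (mk_smap (mono _ _ mx_ge')).
split; [exact: fact | exact: fact |].
apply: smap_natP => i; rewrite !smap_compE !mk_smapE.
have := congr1 (@nat_of_ord _) (bbi (mx i)); rewrite !joinE.
have := mx_ge i; have := mx_ge' i; do 2 case: ifP; lia.
Qed.

(** * CoCartesian edges and left outer horns *)

Definition lhorn n : subsset (Delta (1 + n.+1)) := @horn (1 + n.+1) ord0.

(** The face of [1] * [n] opposite to the vertex 1, in the form in which it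
    occurs in [under_res]. *)
Definition tail_face n : smap (0 + n.+1) (1 + n.+1) :=
  smap_join (vertex (ord0 : 'I_2)) (smap_id n).

Lemma tail_faceE n i : tail_face n i = bump 1 i :> nat.
Proof.
have := ltn_ord i; rewrite joinE; case: (ltnP i 1) => i0 im; rewrite !mk_smapE /=.
  by rewrite /bump; lia.
by rewrite inordK /bump; lia.
Qed.

Lemma tail_face_face n : tail_face n = face n.+1 1.
Proof. by apply: smap_natP => i; rewrite tail_faceE faceE. Qed.

Lemma lhorn_face n j : 0 < j < n.+3 ->
  smem (lhorn n) (face n.+1 j : Delta n.+2 n.+1).
Proof.
by move=> /andP[j0 jn]; apply: (@face_in_horn n.+1 ord0 (Ordinal jn)); rewrite -lt0n.
Qed.

Lemma tail_face_in n : smem (lhorn n) (tail_face n : Delta _ _).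
Proof.
exists (inord 1); first by apply/eqP => /(congr1 (@nat_of_ord _)); rewrite inordK.
move=> i; apply/eqP => /(congr1 (@nat_of_ord _)).
by rewrite inordK // tail_faceE /bump; lia.
Qed.

Lemma inl_in n : smem (lhorn n) (smap_inl 1 n : Delta _ _).
Proof.
exists ord_max; first by apply/eqP => /(congr1 (@nat_of_ord _)).
move=> i; apply/eqP => /(congr1 (@nat_of_ord _)).
by rewrite inlE /=; have := ltn_ord i; lia.
Qed.

Lemma join_in n k (z : smap k n) : smem (bd n) (z : Delta _ _) ->
  smem (lhorn n) (smap_join (smap_id 1) z : Delta _ _).
Proof.
move=> [j zj]; have jb : 2 + j < (1 + n.+1).+1 by have := ltn_ord j; lia.
exists (Ordinal jb); first by apply/eqP => /(congr1 (@nat_of_ord _)).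
move=> i; apply/eqP => /(congr1 (@nat_of_ord _)); rewrite joinE [X in _ = X]/=.
case: ifP => _; first by have := ltn_ord (smap_id 1 (inord i)); lia.
move=> zi; have := zj (inord (i - 2)); apply/negP/negPn/eqP/ord_inj; lia.
Qed.

Definition edge01 n : lhorn n 1 := exist _ (smap_inl 1 n : Delta _ _) (inl_in n).

(** By adjunction between joins and slices, this is the definition of a
    coCartesian edge: Delta^1 * bd Delta^n together with Delta^0 * Delta^n is
    the horn of Delta^1 * Delta^n at its initial vertex. *)
Definition cocart_lift X Y (p : shom X Y) (f : X 1) : Prop :=
  forall n (u : shom (lhorn n) X) (v : shom (Delta (1 + n.+1)) Y),
    u 1 (edge01 n) = f -> shom_comp p u = shom_comp v (incl (lhorn n)) ->
    exists w : shom (Delta (1 + n.+1)) X,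
      shom_comp w (incl (lhorn n)) = u /\ shom_comp p w = v.

Section Generators.
Variable n : nat.

(** The edge 01 is a separate generator since, for n = 0, the boundary of
    Delta^n is empty and no simplex of the third kind contains it. *)
Inductive lhorn_gen :=
  | GTail
  | GEdge
  | GJoin k (z : smap k n) of smem (bd n) (z : Delta _ _).

Definition gdim (i : lhorn_gen) : nat :=
  match i with
  | GTail => 0 + n.+1
  | GEdge => 1
  | GJoin k _ _ => 1 + k.+1
  end.

Definition gsimplex (i : lhorn_gen) : Delta (1 + n.+1) (gdim i) :=
  match i with
  | GTail => tail_face n
  | GEdge => smap_inl 1 n
  | GJoin k z _ => smap_join (smap_id 1) z
  end.

Lemma gsimplex_in i : smem (lhorn n) (gsimplex i).
Proof.
case: i => [||k z zb]; [exact: tail_face_in | exact: inl_in | exact: join_in].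
Qed.

End Generators.

Lemma lhorn_cover n m (y : Delta (1 + n.+1) m) : smem (lhorn n) y ->
  exists (i : lhorn_gen n) (a : smap m (gdim i)), y = act a (gsimplex i).
Proof.
move=> [j j0 yj].
have yjn i : y i != j :> nat by exact: yj.
have jle := ltn_ord j.
have jgt : 0 < j by move: j0; rewrite -(inj_eq (@ord_inj _)) /=; lia.
case: (ltnP 1 j) => [j1|j1]; last first.
  have j1e : j = 1 :> nat by lia.
  have [||a ->] := @face_factor m n.+1 y 1 => //.
    by move=> i; rewrite -j1e.
  by exists (GTail n), a; rewrite /= tail_face_face.
case: n => [|n] in y j j0 yj yjn jle jgt j1 *.
  have [||a ->] := @smap_factor m 1 _ (smap_inl 1 0) y; first exact: smap_inl_inj.
    move=> i; have yi : y i < 2.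
      by have : y i < 3 := ltn_ord (y i); have := yjn i; move: jle; lia.
    by exists (Ordinal yi); apply: ord_inj; rewrite inlE.
  by exists (GEdge 0), a.
have [||a ->] := @face_factor m n.+2 y j => //.
have zb : smem (bd n.+1) (face n (j - 2) : Delta _ _).
  exists (inord (j - 2)) => i; apply/eqP => /(congr1 (@nat_of_ord _)) /eqP.
  by rewrite inordK ?(negbTE (face_miss _ _)) //; lia.
exists (GJoin zb), a => /=; congr smap_comp.
apply: smap_natP => i; move: (ltn_ord i); rewrite faceE joinE.
move: (nat_of_ord i) => {}i il.
case: ifP => i1; first by rewrite mk_smapE inordK /bump; lia.
by rewrite faceE inordK /bump; lia.
Qed.

Lemma tail_join n k (z : smap k n) :
  smap_comp (tail_face n) (smap_join (smap_id 0) z)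
  = smap_comp (smap_join (smap_id 1) z) (tail_face k).
Proof. by rewrite /tail_face -!join_comp Delta_act_id !smap_comp_id Delta_act_id. Qed.

Lemma tail_inl n :
  smap_comp (tail_face n) (smap_inl 0 n)
  = smap_comp (smap_inl 1 n) (vertex (ord0 : 'I_2)).
Proof. exact: join_inl. Qed.

Lemma tail_face_inj n : injective (tail_face n).
Proof. by rewrite tail_face_face; exact: face_inj. Qed.

(** The tail face meets the edge 01 only in the vertex 0. *)
Lemma tail_inl_dec n m (a : smap m (0 + n.+1)) (b : smap m 1) :
  smap_comp (tail_face n) a = smap_comp (smap_inl 1 n) b ->
  exists c : smap m 0,
    a = smap_comp (smap_inl 0 n) c /\ b = smap_comp (vertex (ord0 : 'I_2)) c.
Proof.
move=> ab; exists (smap_const m ord0).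
have abi i : bump 1 (a i) = b i.
  by rewrite -tail_faceE -smap_compE ab smap_compE inlE.
split; apply: smap_natP => i; rewrite smap_compE; have := ltn_ord (b i); have := abi i.
  by rewrite inlE mk_smapE /bump /=; lia.
by rewrite mk_smapE /bump /=; lia.
Qed.

Lemma tail_join_dec n k m (z : smap k n) (a : smap m (0 + n.+1))
    (b : smap m (1 + k.+1)) :
  smap_comp (tail_face n) a = smap_comp (smap_join (smap_id 1) z) b ->
  exists c : smap m (0 + k.+1),
    a = smap_comp (smap_join (smap_id 0) z) c /\ b = smap_comp (tail_face k) c.
Proof.
move=> ab.
have [||c bc] := @face_factor m k.+1 b 1 => //.
  move=> i; have := congr1 (fun t : smap m (1 + n.+1) => t i : nat) ab.
  rewrite !smap_compE tail_faceE => abi; apply/eqP => bi.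
  by move: abi; rewrite (@join_inlE _ _ _ _ _ _ _ ord_max) // mk_smapE /bump /=; lia.
exists c; rewrite tail_face_face; split=> //; apply: smapP => i.
apply: (@tail_face_inj n).
by rewrite -!smap_compE ab bc !Delta_act_comp tail_join tail_face_face.
Qed.

(** A square from the boundary of Delta^n to [cocart_cmp p f] consists of a
    simplex on the tail face, the edge f, and a simplex on [1] * z for each z in
    the boundary, with values in X, together with a simplex of Y on the whole
    join.  The first three glue to a map from the left outer horn. *)
Lemma cocart_lift_cocart X Y (p : shom X Y) (f : X 1) :
  cocart_lift p f -> cocartesian p f.
Proof.
move=> lift n u v uv.
pose vE := v n (smap_id n).
pose a : under (src f) n := (sval vE).1.
pose b : under (p 1 f) n := (sval vE).2.
have ab : p _ (sval a) = act (tail_face n) (sval b) := congr1 sval (svalP vE).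
have uvz k (z : bd n k) :
    sval (cocart_cmp p f k (u k z)) = act (sval z : smap k n) (sval vE).
  have -> : cocart_cmp p f k (u k z) = v k (sval z).
    exact: (congr1 (fun h : shom (bd n) _ => h k z) uv).
  by rewrite (shom_simplexE v).
have ua k (z : bd n k) : act (tail_face k) (sval (u k z))
    = act (smap_join (smap_id 0) (sval z : smap k n)) (sval a).
  exact: (congr1 (fun t => sval t.1) (uvz k z)).
have ub k (z : bd n k) : p _ (sval (u k z))
    = act (smap_join (smap_id 1) (sval z : smap k n)) (sval b).
  exact: (congr1 (fun t => sval t.2) (uvz k z)).
pose x (i : lhorn_gen n) : X (gdim i) :=
  match i with
  | GTail => sval a
  | GEdge => f
  | GJoin k z zb => sval (u k (exist _ z zb))
  end.
have tail_edge m (c : smap m (0 + n.+1)) (d : smap m 1) :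
    smap_comp (tail_face n) c = smap_comp (smap_inl 1 n) d -> act c (sval a) = act d f.
  by move=> /tail_inl_dec[c' [-> ->]]; rewrite !act_comp (svalP a).
have tail_join m k (z : smap k n) (zb : smem (bd n) (z : Delta n k))
    (c : smap m (0 + n.+1)) (d : smap m (1 + k.+1)) :
    smap_comp (tail_face n) c = smap_comp (smap_join (smap_id 1) z) d ->
    act c (sval a) = act d (sval (u k (exist _ z zb))).
  by move=> /tail_join_dec[c' [-> ->]]; rewrite !act_comp ua.
have edge_join m k (z : smap k n) (zb : smem (bd n) (z : Delta n k))
    (c : smap m 1) (d : smap m (1 + k.+1)) :
    smap_comp (smap_inl 1 n) c = smap_comp (smap_join (smap_id 1) z) d ->
    act c f = act d (sval (u k (exist _ z zb))).
  move=> cd; have [||c' dc] := @smap_factor m 1 _ (smap_inl 1 k) d.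
  - exact: smap_inl_inj.
  - move=> i; have di : d i < 2.
      by rewrite -(join_lt z) -smap_compE -cd smap_compE inlE ltn_ord.
    by exists (Ordinal di); apply: ord_inj; rewrite inlE.
  have -> : c = c'.
    apply: smapP => i; apply: (@smap_inl_inj 1 n).
    by rewrite -!smap_compE cd dc !Delta_act_comp join_inl Delta_act_id.
  by rewrite dc act_comp (svalP (u k _)).
have join_join m k (z : smap k n) (zb : smem (bd n) (z : Delta n k))
    k' (z' : smap k' n) (zb' : smem (bd n) (z' : Delta n k'))
    (c : smap m (1 + k.+1)) (d : smap m (1 + k'.+1)) :
    smap_comp (smap_join (smap_id 1) z) c = smap_comp (smap_join (smap_id 1) z') d ->
    act c (sval (u k (exist _ z zb))) = act d (sval (u k' (exist _ z' zb'))).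
  move=> /join_dec[[y [-> ->]]|[s [r [r' [-> -> rr']]]]].
    by rewrite !act_comp (svalP (u k _)) (svalP (u k' _)).
  rewrite !act_comp; congr act.
  have := congr1 sval (app_act u r (exist _ z zb)) => /= <-.
  have := congr1 sval (app_act u r' (exist _ z' zb')) => /= <-.
  by congr (sval (u m _)); exact: sig_inj.
have [|U UE] := shom_glue (@gsimplex_in n) (@lhorn_cover n) (x := x).
  move=> [||k z zb] [||k' z' zb'] m c d /= cd.
  - congr act; apply: smapP => i; apply: (@tail_face_inj n).
    by rewrite -!smap_compE cd.
  - exact: tail_edge.
  - exact: tail_join.
  - by apply/esym/tail_edge.
  - congr act; apply: smapP => i; apply: (@smap_inl_inj 1 n).
    by rewrite -!smap_compE cd.
  - exact: edge_join.
  - by apply/esym/tail_join.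
  - by apply/esym/edge_join.
  - exact: join_join.
have [||W [WU pW]] := lift n U (simplex_map (sval b)).
- by rewrite -[RHS](UE (GEdge n)); congr (U 1 _); exact: sig_inj.
- apply: (shom_gen_ext (e_in := @gsimplex_in n) (@lhorn_cover n)) => i.
  rewrite /= UE; case: i => [||k z zb] /=; first exact: ab.
    by rewrite (svalP b).
  exact: ub.
pose t := W _ (smap_id (1 + n.+1)).
have Wt m (g : smap m (1 + n.+1)) : act g t = W m g by rewrite -shom_simplexE.
have WE i : W _ (gsimplex i) = x i.
  by rewrite -UE -WU.
have tf : act (smap_inl 1 n) t = f by rewrite Wt (WE (GEdge n)).
exists (simplex_map (exist _ t tf : under f n)); split.
  apply: shomP => k [z zb]; apply: sig_inj => /=.
  by rewrite Wt (WE (GJoin zb)).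
apply: shom_Delta_ext; apply: sig_inj.
rewrite -[RHS]/(sval vE) [RHS]surjective_pairing.
congr pair; apply: sig_inj; rewrite /= join_id act_id.
  by rewrite Wt; exact: (WE (GTail n)).
by rewrite -[p _ t]/(shom_comp p W _ _) pW simplex_map_id.
Qed.

Lemma shom_sub_eq K (A : subsset K) X (U : shom A X) m (y y' : K m) h h' :
  y = y' -> U m (exist _ y h) = U m (exist _ y' h').
Proof. by move=> e; congr (U m _); exact: sig_inj. Qed.

(** Restricting a map from the left outer horn along the generators gives the
    square; its diagonal is a simplex of X under f, that is, a simplex on the
    join whose restriction to each generator is the prescribed one. *)
Lemma cocart_cocart_lift X Y (p : shom X Y) (f : X 1) :
  cocartesian p f -> cocart_lift p f.
Proof.
move=> pf n U V Uf UV.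
have pU m (y : Delta (1 + n.+1) m) (h : smem (lhorn n) y) :
    p m (U m (exist _ y h)) = V m y.
  exact: (congr1 (fun g : shom (lhorn n) Y => g m (exist _ y h)) UV).
have Vid m (y : smap m (1 + n.+1)) : act y (V _ (smap_id _)) = V m y.
  by rewrite -shom_simplexE.
have u_in k (z : bd n k) : act (smap_inl 1 k)
    (U _ (exist _ (smap_join (smap_id 1) (sval z : smap k n) : Delta _ _)
                  (join_in (svalP z)))) = f.
  rewrite -app_act -[RHS]Uf; apply: shom_sub_eq.
  by rewrite /= join_inl Delta_act_id.
pose u_fun k (z : bd n k) : under f k := exist _ _ (u_in k z).
have u_act m k (g : smap m k) (z : bd n k) : u_fun m (act g z) = act g (u_fun k z).
  apply: sig_inj; rewrite /= -app_act; apply: shom_sub_eq.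
  by rewrite /= -join_comp smap_comp_id.
pose u : shom (bd n) (under f) := SHom u_act.
have a_in : act (smap_inl 0 n) (U _ (exist _ _ (tail_face_in n))) = src f.
  rewrite -app_act -[in RHS]Uf /src -app_act; apply: shom_sub_eq.
  exact: tail_inl.
pose a : under (src f) n := exist _ _ a_in.
have b_in : act (smap_inl 1 n) (V _ (smap_id (1 + n.+1))) = p 1 f.
  by rewrite Vid -Uf pU.
pose b : under (p 1 f) n := exist _ _ b_in.
have ab : under_map (erefl (p 0 (src f))) n a = under_res (src_nat p f) n b.
  by apply: sig_inj; rewrite /= pU -[smap_join _ _]/(tail_face n) Vid.
pose v := simplex_map (exist _ (a, b) ab : fiber_prod _ _ n).
have [|w [wu wv]] := pf n u v.
  apply: shomP => k z; apply: sig_inj => /=; congr pair; apply: sig_inj => /=.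
    rewrite -!app_act; apply: shom_sub_eq; exact/esym/tail_join.
  by rewrite pU Vid.
pose t := sval (w n (smap_id n)).
have wE : sval (cocart_cmp p f n (w n (smap_id n))) = (a, b).
  by rewrite -[cocart_cmp _ _ _ _]/(shom_comp (cocart_cmp p f) w n _) wv simplex_map_id.
have ta : act (tail_face n) t = sval a := congr1 (fun s => sval s.1) wE.
have tb : p _ t = sval b := congr1 (fun s => sval s.2) wE.
have tu k (z : bd n k) :
    act (smap_join (smap_id 1) (sval z : smap k n)) t = sval (u k z).
  have <- : w k (sval z) = u k z by rewrite -wu.
  by rewrite (shom_simplexE w).
exists (simplex_map t); split; last first.
  by apply: shom_Delta_ext; rewrite /= act_id tb.
apply: (shom_gen_ext (e_in := @gsimplex_in n) (@lhorn_cover n)) => i.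
case: i => [||k z zb] /=.
- by rewrite ta; exact: shom_sub_eq.
- by rewrite (svalP (w n _)) -Uf; exact: shom_sub_eq.
- by rewrite (tu k (exist _ z zb)); exact: shom_sub_eq.
Qed.

(** * Skeleta and homotopy categories of positive degree *)

Definition prodS_mapl B' B (u : shom B' B) Z : shom (prodS B' Z) (prodS B Z).
Proof.
exists (fun n x => (u n x.1, x.2)) => m n f x.
by rewrite /= app_act.
Defined.

Lemma rel_homotopy_pre B' B (A' : subsset B') (A : subsset B) X (u : shom B' B)
    (f g : shom B X) h :
  (forall n (b : B' n), smem A' b -> smem A (u n b)) -> rel_homotopy A f g h ->
  rel_homotopy A' (shom_comp f u) (shom_comp g u)
    (shom_comp h (prodS_mapl u (Delta 1))).
Proof.
move=> uA [h0 h1 hA]; split=> n b; first exact: h0 n (u n b).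
  exact: h1 n (u n b).
by move=> t /uA bA; exact: hA n (u n b) t bA.
Qed.

Lemma homotopic_pre B' B (A' : subsset B') (A : subsset B) X (u : shom B' B)
    (f g : shom B X) :
  (forall n (b : B' n), smem A' b -> smem A (u n b)) -> homotopic A f g ->
  homotopic A' (shom_comp f u) (shom_comp g u).
Proof.
move=> uA [[h fgh] [h' gfh]]; split.
  by exists (shom_comp h (prodS_mapl u (Delta 1))); exact: rel_homotopy_pre fgh.
by exists (shom_comp h' (prodS_mapl u (Delta 1))); exact: rel_homotopy_pre gfh.
Qed.

Definition corestr K (A : subsset K) X (u : shom X K)
    (uA : forall n (x : X n), smem A (u n x)) : shom X A.
Proof.
exists (fun n x => exist _ (u n x) (uA n x)) => m n f x.
by apply: sig_inj; exact: app_act.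
Defined.

Lemma sk_low_dim j (K : sset) n (x : K n) : n <= j -> smem (sk j K) x.
Proof. by exists n, (smap_id n), x; rewrite act_id. Qed.

Lemma sk_le j j' (K : sset) n (x : K n) :
  j <= j' -> smem (sk j K) x -> smem (sk j' K) x.
Proof. by move=> jj' [m [f [y [mj ->]]]]; exists m, f, y; rewrite (leq_trans mj). Qed.

Lemma sk_sub j (K : sset) (A : subsset K) n (x : K n) (xA : smem A x) :
  (forall m (y : K m), m <= j -> smem A y) -> smem (sk j K) x ->
  smem (sk j A) (exist _ x xA : A n).
Proof.
move=> skA [m [f [y [mj xy]]]]; exists m, f, (exist _ y (skA m y mj) : A m).
by split=> //; apply: sig_inj.
Qed.

Lemma sk_in j (K : sset) (A : subsset K) n (x : K n) :
  (forall m (y : K m), m <= j -> smem A y) -> smem (sk j K) x -> smem A x.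
Proof. by move=> skA [m [f [y [mj ->]]]]; apply/smem_act/skA. Qed.

(** A simplicial subset that contains the simplices of dimension at most j has
    the same j-skeleton as the ambient simplicial set; this is the nontrivial
    direction of that identification. *)
Definition sk_restr j K (A : subsset K)
    (skA : forall m (y : K m), m <= j -> smem A y) : shom (sk j K) (sk j A) :=
  corestr (u := corestr (u := incl (sk j K)) (fun n x => sk_in skA (svalP x)))
          (fun n x => sk_sub (sk_in skA (svalP x)) skA (svalP x)).

Section HRep.
Variables (e : nat) (C H : sset) (r : hrep e C H).

Let theta_r : shom C H := hcl r (hmaps_res e (shom_id C)).

(** The class of a map is determined by its restriction to the (e+1)-skeleton,
    which is already contained in A. *)
Lemma hrep_restr_inj K (A : subsset K) (u v : shom K H) :
  (forall m (y : K m), m <= e.+1 -> smem A y) ->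
  shom_comp u (incl A) = shom_comp v (incl A) -> u = v.
Proof.
move=> skA; have [g <-] := hcl_surj r u; have [g' <-] := hcl_surj r v.
rewrite !(hcl_nat r) => /(hcl_eq r) gg'; apply/(hcl_eq r).
have := homotopic_pre (u := sk_restr skA) (A' := sub_in (sk e K) (sk e.+1 K)) _ gg'.
have E (t : hmaps e K C) :
    shom_comp (sval (hmaps_pre (incl A) t)) (sk_restr skA) = sval t.
  by apply: shomP => n [x xs]; congr (sval t n _); exact: sig_inj.
rewrite !E; apply=> n [x xs] /= xe; apply: sk_sub => // m y me.
exact/skA/leqW.
Qed.

(** The representative and its extension live on the skeleta up to dimension
    e + 2, and these are the same for A and K. *)
Lemma hrep_restr_surj K (A : subsset K) (u : shom A H) :
  (forall m (y : K m), m <= e.+2 -> smem A y) ->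
  exists w : shom K H, shom_comp w (incl A) = u.
Proof.
move=> skA; have skA' m (y : K m) (me : m <= e.+1) : smem A y by exact/skA/leqW.
have [[g gext] <-] := hcl_surj r u; have [F FE] := gext.
have ext : extends_to (sk e.+2 K) (shom_comp g (sk_restr skA')).
  exists (shom_comp F (sk_restr skA)) => n x xB xC /=.
  have := FE n (exist _ x (sk_in skA' xB)) (sk_sub (sk_in skA' xB) skA' xB)
    (sk_sub (sk_in skA' xB) skA xC).
  have Eg : g n (sk_restr skA' n (exist _ x xB))
      = g n (exist _ _ (sk_sub (sk_in skA' xB) skA' xB)).
    by congr (g n _); do 2 apply: sig_inj.
  have EF : F n (sk_restr skA n (exist _ x xC))
      = F n (exist _ _ (sk_sub (sk_in skA' xB) skA xC)).
    by congr (F n _); do 2 apply: sig_inj.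
  by rewrite -Eg -EF.
exists (hcl r (exist _ _ ext)); rewrite (hcl_nat r); congr hcl.
apply: sig_inj; apply: shomP => n [[x xA] xs] /=.
by apply: shom_sub_eq; exact: sig_inj.
Qed.

Lemma theta_hrep_comp K (g : shom K C) : shom_comp theta_r g = hcl r (hmaps_res e g).
Proof.
rewrite (hcl_nat r); congr hcl; apply: sig_inj; exact: shomP.
Qed.

(** When K has dimension at most e + 2, the extension required of a
    representative is a map defined on all of K. *)
Lemma theta_hrep_lift K (u : shom K H) : (forall m (y : K m), smem (sk e.+2 K) y) ->
  exists g : shom K C, shom_comp theta_r g = u.
Proof.
move=> Ksk; have [[g gext] <-] := hcl_surj r u; have [F FE] := gext.
exists (shom_comp F (corestr (u := shom_id K) Ksk)).
rewrite theta_hrep_comp; congr hcl; apply: sig_inj; apply: shomP => n [x xs] /=.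
exact: FE.
Qed.

Lemma theta_hrep_homotopic n (x y : C n) : theta_r n x = theta_r n y ->
  homotopic (sub_in (sk e (Delta n)) (sk e.+1 (Delta n)))
    (shom_comp (simplex_map x) (incl _)) (shom_comp (simplex_map y) (incl _)).
Proof.
move=> xy; apply/(hcl_eq r (hmaps_res e (simplex_map x)) (hmaps_res e (simplex_map y))).
rewrite -!theta_hrep_comp; apply: shom_Delta_ext.
by rewrite /= !act_id.
Qed.

(** In dimension at most e the homotopy is relative to the whole simplex, hence
    constant. *)
Lemma theta_hrep_inj_low n (x y : C n) : n <= e -> theta_r n x = theta_r n y -> x = y.
Proof.
move=> ne /theta_hrep_homotopic[[h [h0 h1 hA]] _].
pose i : sk e.+1 (Delta n) n :=
  exist _ (smap_id n : Delta n n) (sk_low_dim _ (leqW ne)).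
have := hA n i (smap_const n ord_max) (sk_low_dim _ ne); rewrite h1.
by rewrite /= !act_id.
Qed.

End HRep.

Lemma bd_sk n m (z : Delta n.+1 m) : smem (bd n.+1) z -> smem (sk n (Delta n.+1)) z.
Proof.
move=> [j zj]; have [||y ->] := @face_factor m n z j => //.
  exact: leq_ord.
by exists n, y, (face n j : Delta _ _).
Qed.

(** Below dimension d homotopies are constant, in dimension d the first axiom of
    a d-category applies, and above d simplices are determined by their
    boundary, on which induction applies. *)
Lemma theta_hrep_inj e (D H : sset) (r : hrep e D H) n (x y : D n) :
  d_category e.+1 D ->
  hcl r (hmaps_res e (shom_id D)) n x = hcl r (hmaps_res e (shom_id D)) n y -> x = y.
Proof.
move=> [_ Dd Dm]; elim: n x y => [|n IH] x y xy.
  exact: theta_hrep_inj_low xy.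
case: (ltnP e n.+1) => ne; last exact: theta_hrep_inj_low xy.
apply: simplex_map_inj.
case: (ltngtP e.+1 n.+1) => [en|en|[en]].
- apply: Dm => //; apply: shomP => m [z [j zj]] /=.
  have [||z' ->] := @face_factor m n z j => //; first exact: leq_ord.
  by rewrite !act_comp; congr act; apply: IH; rewrite !app_act xy.
- by lia.
rewrite -en in x y xy *; apply: Dd.
have idsk m (z : Delta e.+1 m) : smem (sk e.+1 (Delta e.+1)) z.
  by exists e.+1, z, (smap_id e.+1 : Delta _ _); rewrite /= smap_comp_id.
have := homotopic_pre (u := corestr (u := shom_id (Delta e.+1)) idsk) (A' := bd e.+1)
  _ (theta_hrep_homotopic xy).
have E (t : D e.+1) : shom_comp (shom_comp (simplex_map t) (incl _))
    (corestr (u := shom_id (Delta e.+1)) idsk) = simplex_map t by exact: shomP.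
by rewrite !E; apply=> m z /bd_sk.
Qed.

(** * Lifting horns along theta in positive degree *)

(** A simplex of dimension m has at most m + 1 vertices. *)
Lemma smap_miss m n (y : smap m n) (B : {set 'I_n.+1}) : #|B| + m < n ->
  exists2 j, j \notin B & forall i, y i != j.
Proof.
move=> mn; have lt : #|B :|: [set y i | i in 'I_m.+1]| < n.+1.
  rewrite ltnS; apply: leq_trans mn; apply: leq_trans (leq_card_setU _ _).1 _.
  rewrite -addnS leq_add2l; apply: leq_trans (leq_imset_card _ _) _.
  by rewrite card_ord.
case: (pickP (fun j => j \notin B :|: [set y i | i in 'I_m.+1])) => [j|all_in].
  rewrite inE negb_or => /andP[jB jy]; exists j => // i.
  by apply: contraNneq jy => <-; exact: imset_f.
suff : n.+1 <= #|B :|: [set y i | i in 'I_m.+1]| by rewrite leqNgt lt.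
rewrite -{1}[n.+1]card_ord -cardsT; apply/subset_leq_card/subsetP => j _.
exact: negbFE (all_in j).
Qed.

Lemma horn_low_dim n (l : 'I_n.+1) m (y : Delta n m) :
  m.+1 < n -> smem (horn l) y.
Proof.
move=> mn; have [|j jl yj] := @smap_miss m n y [set l]; first by rewrite cards1.
by exists j; rewrite ?inE // in jl *.
Qed.

Lemma bd_low_dim n m (y : Delta n m) : m < n -> smem (bd n) y.
Proof.
move=> mn; have [|j _ yj] := @smap_miss m n y set0; first by rewrite cards0.
by exists j.
Qed.

Lemma horn_sk n (l : 'I_n.+2) m (y : horn l m) : smem (sk n (horn l)) y.
Proof.
case: y => y yl; have [[j jl] [a ya]] := horn_cover yl.
exists n, a, (exist _ _ (face_in_horn jl)); split=> //.
exact: sig_inj.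
Qed.

Section HRepMap.
Variables (e : nat) (C D H H' : sset) (r : hrep e C H) (r' : hrep e D H').
Variables (p : shom C D) (hp : shom H H').
Hypothesis D_cat : d_category e.+1 D.
Hypothesis hpE : forall K (g : hmaps e K C),
  shom_comp hp (hcl r g) = hcl r' (hmaps_post p g).

Let thC : shom C H := hcl r (hmaps_res e (shom_id C)).
Let thD : shom D H' := hcl r' (hmaps_res e (shom_id D)).

Lemma theta_hrep_nat : shom_comp hp thC = shom_comp thD p.
Proof.
rewrite hpE (hcl_nat r'); congr hcl; apply: sig_inj; exact: shomP.
Qed.

Lemma theta_hrep_mono K (u v : shom K D) : shom_comp thD u = shom_comp thD v -> u = v.
Proof.
move=> uv; apply: shomP => n x; apply: (theta_hrep_inj (r := r')) => //.
exact: (congr1 (fun g : shom K H' => g n x) uv).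
Qed.

(** Up to dimension e + 2 this is the lifting of low-dimensional maps.  In
    dimension e + 3 only an inner horn lifts that way; it is filled in D, and
    the filler has the right class because the horn contains all simplices of
    dimension at most e + 1. *)
Lemma theta_hrep_Delta_lift n (v : shom (Delta n) H') : n <= e.+3 ->
  exists v', shom_comp thD v' = v.
Proof.
rewrite leq_eqVlt => /orP[/eqP en|ne]; last first.
  apply: (theta_hrep_lift r') => m y.
  by exists n, y, (smap_id n : Delta n n); split=> //=; rewrite smap_comp_id.
rewrite {}en in v *; pose l : 'I_e.+4 := inord 1.
have l1 : l = 1 :> nat by rewrite inordK.
have [g gv] := theta_hrep_lift r' (shom_comp v (incl (horn l))) (@horn_sk _ l).
have [|w wg] := (let: And3 D_inf _ _ := D_cat in D_inf) _ l _ g; first by rewrite l1.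
exists w; apply: (hrep_restr_inj r' (A := horn l)).
  by move=> m y me; apply: horn_low_dim.
by rewrite -gv -wg shom_compA.
Qed.

(** Injectivity of [theta] on D turns commutativity over h_d p into
    commutativity over p. *)
Lemma hrep_square_lift K (A : subsset K) (u : shom A H) v (g : shom A C) v' :
  shom_comp hp u = shom_comp v (incl A) -> shom_comp thC g = u ->
  shom_comp thD v' = v -> shom_comp p g = shom_comp v' (incl A).
Proof.
move=> uv gE v'E; apply: theta_hrep_mono.
by rewrite shom_compA -theta_hrep_nat -shom_compA gE uv -v'E shom_compA.
Qed.

Lemma theta_hrep_horn_lift n (l : 'I_n.+2) (u : shom (horn l) H) : n <= e.+2 ->
  exists g, shom_comp thC g = u.
Proof.
move=> ne; apply: (theta_hrep_lift r) => m y; apply: sk_le ne _; exact: horn_sk.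
Qed.

Lemma hrep_horn_large n (l : 'I_n.+1) : e.+3 < n -> has_rlp (horn l) hp.
Proof.
move=> ne u v uv.
have low m (y : Delta n m) : m <= e.+2 -> smem (horn l) y.
  by move=> me; apply: horn_low_dim; lia.
have [w wu] := hrep_restr_surj r u low; exists w; split=> //.
apply: (hrep_restr_inj r' (A := horn l)).
  by move=> m y me; apply: low; exact: leqW.
by rewrite -uv -wu shom_compA.
Qed.

Lemma hrep_lift_descend K (A : subsset K) (u : shom A H) v (g : shom A C) v' :
  shom_comp thC g = u -> shom_comp thD v' = v ->
  (exists w : shom K C, shom_comp w (incl A) = g /\ shom_comp p w = v') ->
  exists w : shom K H, shom_comp w (incl A) = u /\ shom_comp hp w = v.
Proof.
move=> <- <- [w [<- <-]]; exists (shom_comp thC w); split; first by rewrite shom_compA.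
by rewrite !shom_compA theta_hrep_nat.
Qed.

Lemma hrep_inner : inner_fibration p -> inner_fibration hp.
Proof.
move=> p_inner [|n] l ln; first by move: ln; rewrite ltn0 andbF.
case: (leqP n e.+2) => ne; last exact: hrep_horn_large.
move=> u v uv; have [g gu] := theta_hrep_horn_lift u ne.
have [v' v'v] := theta_hrep_Delta_lift v (ne : n.+1 <= e.+3).
apply: (hrep_lift_descend gu v'v); apply: p_inner => //.
exact: hrep_square_lift uv gu v'v.
Qed.

End HRepMap.

(** * Replacing an edge by a homotopic one *)

(** Filling a horn given by its faces; [l] is the position of the missing one. *)
Lemma horn_fill n (l : 'I_n.+3) (X : sset) (x : nat -> X n.+1) :
  infty_category X -> 0 < l < n.+2 ->
  (forall a b, a <= b -> b <= n.+1 -> a != l -> b.+1 != l ->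
     act (face n a) (x b.+1) = act (face n b) (x a)) ->
  exists w : X n.+2, forall j, j <= n.+2 -> j != l -> act (face n.+1 j) w = x j.
Proof.
move=> X_inf ln xx; have [u uE] := horn_glue xx; have [w wu] := X_inf _ l ln u.
exists (w _ (smap_id _)) => j jn jl; rewrite -shom_simplexE.
have h := face_in_horn (jl : Ordinal (jn : j < n.+3) != l).
by rewrite -(uE _ h jn jl) -wu.
Qed.

Lemma degen_subproof n (i : 'I_n.+2) : i.-1 < n.+1.
Proof. by have := ltn_ord i; lia. Qed.

Lemma degen_mono n (i j : 'I_n.+2) : i <= j ->
  Ordinal (degen_subproof i) <= Ordinal (degen_subproof j).
Proof. by rewrite /=; lia. Qed.

(** The degeneracy repeating the first vertex. *)
Definition degen n : smap n.+1 n := mk_smap (@degen_mono n).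

Lemma degenE n i : degen n i = i.-1 :> nat.
Proof. by rewrite mk_smapE. Qed.

Lemma degen_max_subproof n (i : 'I_n.+2) : minn i n < n.+1.
Proof. by rewrite ltnS geq_minr. Qed.

Lemma degen_max_mono n (i j : 'I_n.+2) : i <= j ->
  Ordinal (degen_max_subproof i) <= Ordinal (degen_max_subproof j).
Proof. by rewrite /=; lia. Qed.

(** The degeneracy repeating the last vertex. *)
Definition degen_max n : smap n.+1 n := mk_smap (@degen_max_mono n).

Lemma degen_maxE n i : degen_max n i = minn i n :> nat.
Proof. by rewrite mk_smapE. Qed.

Definition smapE := (smap_compE, faceE, degenE, degen_maxE, mk_smapE).

Lemma degen_face0 n : smap_comp (degen n) (face n 0) = smap_id n.
Proof. by apply: smap_natP => i; rewrite smap_compE degenE faceE mk_smapE. Qed.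

Lemma degen_face1 n : smap_comp (degen n) (face n 1) = smap_id n.
Proof.
by apply: smap_natP => i; rewrite smap_compE degenE faceE mk_smapE /bump; lia.
Qed.

Lemma degen_face2 n :
  smap_comp (degen n.+1) (face n.+1 2) = smap_comp (face n 1) (degen n).
Proof.
by apply: smap_natP => i; rewrite !smap_compE degenE !faceE degenE /bump; lia.
Qed.

Section Triangles.
Variables (C H : sset) (r : hrep 0 C H).
Hypothesis C_inf : infty_category C.

Let thC : shom C H := hcl r (hmaps_res 0 (shom_id C)).

(** For d = 1 the homotopy category is the nerve of a category, in which a
    triangle is determined by its edges. *)
Lemma hrep_triangle_ext (s t : H 2) :
  (forall j, j <= 2 -> act (face 1 j) s = act (face 1 j) t) -> s = t.
Proof.
move=> st; apply: simplex_map_inj.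
apply: (hrep_restr_inj r (A := bd 2)) => [m y m1|]; first exact: bd_low_dim.
apply: shomP => m [z [j zj]] /=.
have [||z' ->] := @face_factor m 1 z j => //; first exact: leq_ord.
by rewrite !act_comp st // leq_ord.
Qed.

Lemma theta_hrep_vertex_eq (f f' : C 1) (c : smap 0 1) :
  thC 1 f = thC 1 f' -> act c f = act c f'.
Proof.
by move=> ff'; apply: (theta_hrep_inj_low (r := r)); rewrite // !app_act -/thC ff'.
Qed.

(** The square of a homotopy is cut along its diagonal; the two vertical sides
    are degenerate because the homotopy is relative to the endpoints. *)
Lemma homotopy_triangles (f f' : C 1) : thC 1 f = thC 1 f' ->
  exists A B : C 2,
    [/\ act (face 1 2) A = f, act (face 1 0) A = act (smap_const 1 ord_max) f,
        act (face 1 2) B = act (smap_const 1 ord0) f, act (face 1 0) B = f'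
      & act (face 1 1) A = act (face 1 1) B].
Proof.
move=> /(theta_hrep_homotopic (r := r))[[h [h0 h1 hA]] _].
pose i : sk 1 (Delta 1) 1 := exist _ (smap_id 1 : Delta 1 1) (sk_low_dim _ (leqnn 1)).
have iE (x : C 1) m (g : smap m 1) :
    shom_comp (simplex_map x) (incl _) m (act g i) = act g x.
  by rewrite app_act /= act_id.
have ci (c : 'I_2) : smem (sub_in (sk 0 (Delta 1)) (sk 1 (Delta 1)))
    (act (smap_const 1 c) i : sk 1 (Delta 1) 1).
  exists 0, (smap_const 1 ord0), (vertex c : Delta 1 0); split=> //.
  by apply: smapP => k; rewrite !smapE.
pose H2 (g k : smap 2 1) : C 2 := h 2 (act g i, k).
have H2E (g k : smap 2 1) (c : smap 1 2) :
    act c (H2 g k) = h 1 (act (smap_comp g c) i, smap_comp k c).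
  by rewrite -app_act (act_comp (s := sk 1 (Delta 1))).
have hid (c : smap 1 1) : c = smap_id 1 -> forall k, h 1 (act c i, k) = h 1 (i, k).
  by move=> -> k; rewrite act_id.
exists (H2 (degen_max 1) (degen 1)), (H2 (degen 1) (degen_max 1)); rewrite !H2E.
have m2 : smap_comp (degen_max 1) (face 1 2) = smap_id 1.
  by apply: smap_natP => k; have := ltn_ord k; rewrite !smapE /bump; lia.
have m1 : smap_comp (degen_max 1) (face 1 1) = smap_id 1.
  by apply: smap_natP => k; have := ltn_ord k; rewrite !smapE /bump; lia.
have m0 : smap_comp (degen_max 1) (face 1 0) = smap_const 1 ord_max.
  by apply: smap_natP => k; have := ltn_ord k; rewrite !smapE /= /bump; lia.
have d2 : smap_comp (degen 1) (face 1 2) = smap_const 1 ord0.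
  by apply: smap_natP => k; have := ltn_ord k; rewrite !smapE /= /bump; lia.
rewrite m2 m1 m0 d2 degen_face0 degen_face1; split=> //.
- by rewrite h0 iE act_id.
- by rewrite hA // iE.
- by rewrite hA // iE.
- by rewrite h1 iE act_id.
Qed.

(** With f' the edge 01 of T and delta the diagonal of the homotopy, two fillings
    of three-dimensional inner horns turn T = (f', b, c) first into a triangle
    with edges (delta, b, c), then into one with edges (f, b, c). *)
Lemma triangle_replace (T : C 2) (f : C 1) : thC 1 (act (face 1 2) T) = thC 1 f ->
  exists T' : C 2, [/\ act (face 1 2) T' = f, act (face 1 1) T' = act (face 1 1) T
    & act (face 1 0) T' = act (face 1 0) T].
Proof.
move=> Tf; have [A [B [A2 A0 B2 B0 AB]]] := homotopy_triangles (esym Tf).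
set b := act (face 1 0) T; set c := act (face 1 1) T.
have bD0 : act (face 1 0) (act (degen 1) b) = b by rewrite -act_comp degen_face0 act_id.
have bD1 : act (face 1 1) (act (degen 1) b) = b by rewrite -act_comp degen_face1 act_id.
have cD0 : act (face 1 0) (act (degen 1) c) = c by rewrite -act_comp degen_face0 act_id.
have cD1 : act (face 1 1) (act (degen 1) c) = c by rewrite -act_comp degen_face1 act_id.
have const_vertex k (g : C 1) :
    act (smap_const 1 k) g = act (degen 0) (act (vertex k) g).
  by rewrite -act_comp; congr act; apply: smapP => s; rewrite !smapE.
have v0 : act (smap_const 1 ord0) f = act (face 1 2) (act (degen 1) c).
  rewrite const_vertex -(theta_hrep_vertex_eq _ Tf) -[RHS]act_comp degen_face2 act_comp.
  congr act; rewrite /c -face_faceA // -!act_comp; congr act.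
  by apply: smap_natP => k; have := ltn_ord k; rewrite !smapE /= /bump; lia.
have v1 : act (smap_const 1 ord_max) f = act (face 1 2) (act (degen 1) b).
  rewrite const_vertex -(theta_hrep_vertex_eq _ Tf) -[RHS]act_comp degen_face2 act_comp.
  congr act; rewrite /b -!act_comp; congr act.
  by apply: smap_natP => k; have := ltn_ord k; rewrite !smapE /= /bump; lia.
(* vertices src f, src f, tgt f and the third vertex of T *)
pose x j := if j == 0 then T else if j == 2 then act (degen 1) c else B.
have [||w wE] := @horn_fill 1 (inord 1) C x C_inf; rewrite ?inordK //.
  move=> i j ij j2; case: j ij j2 => [|[|[|j]]]; case: i => [|[|[|i]]] //= _ _ _ _.
  exact: etrans B2 v0.
rewrite inordK // in wE.
have w0 := wE 0 isT isT; have w2 := wE 2 isT isT; have w3 := wE 3 isT isT.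
rewrite /x /= in w0 w2 w3.
set Q := act (face 2 1) w.
have Q0 : act (face 1 0) Q = b by rewrite face_faceA // w0.
have Q1 : act (face 1 1) Q = c by rewrite -face_faceA // w2.
have Q2 : act (face 1 2) Q = act (face 1 1) A by rewrite -face_faceA // w3 AB.
(* vertices src f, tgt f, tgt f and the third vertex of T *)
pose y j := if j == 0 then act (degen 1) b else if j == 1 then Q else A.
have [||z zE] := @horn_fill 1 (inord 2) C y C_inf; rewrite ?inordK //.
  move=> i j ij j2; case: j ij j2 => [|[|[|j]]]; case: i => [|[|[|i]]] //= _ _ _ _.
  - by rewrite [LHS]Q0 [RHS]bD0.
  - exact: etrans A0 v1.
rewrite inordK // in zE.
have z0 := zE 0 isT isT; have z1 := zE 1 isT isT; have z3 := zE 3 isT isT.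
rewrite /y /= in z0 z1 z3.
exists (act (face 2 2) z); split.
- by rewrite -face_faceA // z3.
- by rewrite face_faceA // z1.
- by rewrite face_faceA // z0.
Qed.

End Triangles.

Lemma edge01E n k (t : smap 1 k) (s : smap k (1 + n.+1)) (X : sset)
    (u : shom (lhorn n) X) h :
  smap_comp s t = smap_inl 1 n ->
  u 1 (edge01 n) = act t (u k (exist _ (s : Delta _ k) h)).
Proof. by move=> st; rewrite -app_act; apply: shom_sub_eq. Qed.

Section EdgeReplace.
Variables (C H : sset) (r : hrep 0 C H).
Hypothesis C_inf : infty_category C.

Let thC : shom C H := hcl r (hmaps_res 0 (shom_id C)).

(** For n = 0 the horn is a pair of edges, and one of them is replaced; for
    n = 1 the two triangles containing 01 are replaced and their other edges
    kept, so that they still match the third triangle. *)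
Lemma edge_replace n (g : shom (lhorn n) C) (f : C 1) : n <= 1 ->
  thC 1 (g 1 (edge01 n)) = thC 1 f ->
  exists g' : shom (lhorn n) C,
    g' 1 (edge01 n) = f /\ shom_comp thC g' = shom_comp thC g.
Proof.
case: n g => [|[|//]] g _ gf.
- have in1 := @lhorn_face 0 1 isT; have in2 := @lhorn_face 0 2 isT.
  pose x j := if j == 1 then g 1 (exist _ _ in1) else f.
  have edge : smap_comp (face 1 2) (smap_id 1) = smap_inl 1 0.
    by apply: smap_natP => k; have := ltn_ord k; rewrite !smapE /= /bump; lia.
  have g2 : g 1 (exist _ _ in2) = g 1 (edge01 0).
    by rewrite (edge01E _ in2 edge) act_id.
  have [|g' g'E] := @horn_glue 0 ord0 C x.
    case=> [|[|a]] // [|[|b]] // _ _ _ _.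
    rewrite /x /= -(theta_hrep_vertex_eq _ gf) -g2.
    by rewrite -!app_act; apply: shom_sub_eq; apply: face_face.
  exists g'; split; first by rewrite (edge01E g' in2 edge) act_id g'E.
  apply: (@horn_ext 1 ord0) => -[|[|[|j]]] h // _ _; rewrite /= g'E // /x /=.
    by congr (thC 1 _); exact: shom_sub_eq.
  by rewrite -/thC -gf -g2; congr (thC 1 _); exact: shom_sub_eq.
have in1 := @lhorn_face 1 1 isT; have in2 := @lhorn_face 1 2 isT.
have in3 := @lhorn_face 1 3 isT.
have edge2 : smap_comp (face 2 2) (face 1 2) = smap_inl 1 1.
  by apply: smap_natP => k; have := ltn_ord k; rewrite !smapE /= /bump; lia.
have edge3 : smap_comp (face 2 3) (face 1 2) = smap_inl 1 1.
  by apply: smap_natP => k; have := ltn_ord k; rewrite !smapE /= /bump; lia.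
have [|S [S2 S1 S0]] := triangle_replace (r := r) C_inf
  (T := g 2 (exist _ _ in2)) (f := f).
  by rewrite -(edge01E g in2 edge2).
have [|T [T2 T1 T0]] := triangle_replace (r := r) C_inf
  (T := g 2 (exist _ _ in3)) (f := f).
  by rewrite -(edge01E g in3 edge3).
pose x j := if j == 1 then g 2 (exist _ _ in1) else if j == 2 then S else T.
have [|g' g'E] := @horn_glue 1 ord0 C x.
  case=> [|[|[|a]]] // [|[|[|b]]] // _ _ _ _; rewrite /x /=.
  - by rewrite S1 -!app_act; apply: shom_sub_eq; apply: face_face.
  - by rewrite T1 -!app_act; apply: shom_sub_eq; apply: face_face.
  - by rewrite S2 T2.
exists g'; split; first by rewrite (edge01E g' in2 edge2) g'E.
have ext (s t : C 2) : thC 1 (act (face 1 2) s) = thC 1 f ->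
    act (face 1 2) t = f -> act (face 1 1) t = act (face 1 1) s ->
    act (face 1 0) t = act (face 1 0) s -> thC 2 t = thC 2 s.
  move=> s2 t2 t1 t0; apply: (hrep_triangle_ext r) => -[|[|[|j]]] // _.
  - by rewrite -!app_act t0.
  - by rewrite -!app_act t1.
  - by rewrite -!app_act t2 s2.
apply: (@horn_ext 2 ord0) => -[|[|[|[|j]]]] h // _ _; rewrite /= g'E // /x /=.
- by congr (thC 2 _); exact: shom_sub_eq.
- by apply: ext => //; rewrite ?S1 ?S0 -1?(edge01E g h edge2) -1?gf //;
    congr (act _ _); exact: shom_sub_eq.
- by apply: ext => //; rewrite ?T1 ?T0 -1?(edge01E g h edge3) -1?gf //;
    congr (act _ _); exact: shom_sub_eq.
Qed.

End EdgeReplace.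

(** The lift of the horn to C is corrected on the edge 01 only when e = 0, in
    which case n is at most 1. *)
Lemma hrep_cocart_lift e (C D H H' : sset) (r : hrep e C H) (r' : hrep e D H')
    (p : shom C D) (hp : shom H H') (f : C 1) :
  infty_category C -> d_category e.+1 D ->
  (forall K (g : hmaps e K C), shom_comp hp (hcl r g) = hcl r' (hmaps_post p g)) ->
  cocart_lift p f -> cocart_lift hp (hcl r (hmaps_res e (shom_id C)) 1 f).
Proof.
move=> C_inf D_cat hpE pf n u v uf uv.
case: (leqP n.+1 e.+2) => ne; last first.
  by apply: (@hrep_horn_large _ _ _ _ _ r r' hp n.+2 ord0 _ u v uv).
have [g gu] := theta_hrep_horn_lift r (l := ord0 : 'I_n.+3) u ne.
have [v' v'v] := theta_hrep_Delta_lift r' D_cat v (ne : n.+2 <= e.+3).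
have [g' [g'f g'u]] : exists g' : shom (lhorn n) C, g' 1 (edge01 n) = f /\
    shom_comp (hcl r (hmaps_res e (shom_id C))) g' = u.
  have gf : hcl r (hmaps_res e (shom_id C)) 1 (g 1 (edge01 n))
      = hcl r (hmaps_res e (shom_id C)) 1 f by rewrite -uf -gu.
  case: e => [|e] in r r' hpE D_cat ne gu gf uf v'v *.
    have [|g' [g'f g'g]] := edge_replace (r := r) C_inf _ gf => //.
    by exists g'; rewrite g'g.
  by exists g; split=> //; exact: theta_hrep_inj_low gf.
apply: (hrep_lift_descend hpE g'u v'v); apply: pf => //.
exact: (hrep_square_lift D_cat hpE uv g'u v'v).
Qed.

(** * Degree zero: nerves of preorders *)

Lemma srcE (X : sset) (f : X 1) : src f = act (face 0 1) f.
Proof.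
by congr act; apply: smap_natP => i; have := ltn_ord i; rewrite !smapE /= /bump; lia.
Qed.

Lemma tgtE (X : sset) (f : X 1) : tgt f = act (face 0 0) f.
Proof.
by congr act; apply: smap_natP => i; have := ltn_ord i; rewrite !smapE /= /bump; lia.
Qed.

Lemma compose_edges (X : sset) (f g : X 1) : infty_category X -> tgt f = src g ->
  exists w : X 2, [/\ act (face 1 2) w = f, act (face 1 0) w = g,
    src (act (face 1 1) w) = src f & tgt (act (face 1 1) w) = tgt g].
Proof.
move=> X_inf fg; pose x j := if j == 0 then g else f.
have [||w wE] := @horn_fill 0 (inord 1) X x X_inf; rewrite ?inordK //.
  by case=> [|[|a]] // [|[|b]] //; rewrite /x /= -tgtE -srcE.
rewrite inordK // in wE; exists w.
have w0 : act (face 1 0) w = g := wE 0 isT isT.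
have w2 : act (face 1 2) w = f := wE 2 isT isT.
split=> //; first by rewrite !srcE -face_faceA // w2.
by rewrite !tgtE face_faceA // w0.
Qed.

Lemma obj_le_trans (X : sset) (x y z : X 0) : infty_category X ->
  obj_le x y -> obj_le y z -> obj_le x z.
Proof.
move=> X_inf [f [fx fy]] [g [gy gz]].
have [|w [_ _ ws wt]] := @compose_edges _ f g X_inf.
  by rewrite fy.
by exists (act (face 1 1) w); rewrite ws wt.
Qed.

(** Transitivity is what makes the classes of isomorphic objects equal. *)
Lemma iso_class_memE (X : sset) (S : iso_class X) (x : X 0) : infty_category X ->
  sval S x -> S = cls x.
Proof.
case: S => S [z Sz] X_inf /= Sx; apply: sig_inj => /=.
move: Sx; rewrite Sz => -[zx xz]; apply: funext => t; apply/propext; split=> -[a b].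
  by split; [exact: obj_le_trans a | exact: obj_le_trans zx].
by split; [exact: obj_le_trans a | exact: obj_le_trans xz].
Qed.

Lemma cls_le (X : sset) (x y : X 0) : infty_category X ->
  iso_class_le (cls x) (cls y) <-> obj_le x y.
Proof.
move=> X_inf; split=> [[x' [y' [[xx' _] [_ y'y] le]]]|le].
  exact: obj_le_trans (obj_le_trans X_inf xx' le) y'y.
by exists x, y; split=> //; exact: obj_iso_refl.
Qed.

Lemma iso_class_le_trans (X : sset) (S T U : iso_class X) : infty_category X ->
  iso_class_le S T -> iso_class_le T U -> iso_class_le S U.
Proof.
move=> X_inf [x [y [Sx Ty xy]]] [y' [z [Ty' Uz yz]]].
move: Ty'; rewrite (iso_class_memE X_inf Sx) (iso_class_memE X_inf Ty)
  (iso_class_memE X_inf Uz) => -[yy' _].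
apply/cls_le => //; apply: obj_le_trans xy _ => //; exact: obj_le_trans yz.
Qed.

Section Nerve.
Variables (P : Type) (R : P -> P -> Prop).

Definition vtx (s : nerve R 0) : P := sval s ord0.

Lemma vtxE n (s : nerve R n) i : vtx (act (vertex i) s) = sval s i.
Proof. by rewrite /vtx /= mk_smapE. Qed.

Lemma nerve_restr_inj K (A : subsset K) (u v : shom K (nerve R)) :
  (forall y : K 0, smem A y) ->
  shom_comp u (incl A) = shom_comp v (incl A) -> u = v.
Proof.
move=> A0 uv; apply: shomP => n x; apply: sig_inj; apply: funext => i.
rewrite -!vtxE -!app_act; congr vtx.
exact: (congr1 (fun g : shom A _ => g 0 (exist _ _ (A0 (act (vertex i) x)))) uv).
Qed.

Variables (n : nat) (A : subsset (Delta n)) (u : shom A (nerve R)).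
Hypothesis A0 : forall y : Delta n 0, smem A y.

Definition vtx_at (i : 'I_n.+1) : P :=
  vtx (u 0 (exist _ (vertex i : Delta n 0) (A0 _))).

Lemma vtx_at_edge (i j : 'I_n.+1) (ij : i <= j) :
  smem A (smap_pair ij : Delta n 1) -> R (vtx_at i) (vtx_at j).
Proof.
move=> ijA; have := svalP (u 1 (exist _ _ ijA)) ord0 ord_max isT.
rewrite -!vtxE -!app_act; congr R; congr (vtx (u 0 _)); apply: sig_inj => /=;
  by apply: smapP => k; rewrite !smapE.
Qed.

Lemma nerve_restr_surj : (forall i j : 'I_n.+1, i <= j -> R (vtx_at i) (vtx_at j)) ->
  exists w : shom (Delta n) (nerve R), shom_comp w (incl A) = u.
Proof.
move=> nR; pose s : nerve R n := exist _ vtx_at nR; exists (simplex_map s).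
apply: shomP => m [y yA]; apply: sig_inj; apply: funext => i.
rewrite -[RHS]vtxE -app_act /=; congr (vtx (u 0 _)); apply: sig_inj => /=.
by apply: smapP => k; rewrite !smapE.
Qed.

End Nerve.

Section IsoNerve.
Variables (P P' : Type) (R : P -> P -> Prop) (R' : P' -> P' -> Prop) (H H' : sset).
Variables (r : sset_iso (nerve R) H) (r' : sset_iso (nerve R') H') (q : shom H H').

Lemma iso_bwd_inj (X Y : sset) (i : sset_iso X Y) K (u v : shom K Y) :
  shom_comp (iso_bwd i) u = shom_comp (iso_bwd i) v -> u = v.
Proof.
have E (w : shom K Y) : w = shom_comp (iso_fwd i) (shom_comp (iso_bwd i) w).
  by rewrite shom_compA iso_fwdK shom_comp_idl.
by move=> uv; rewrite (E u) (E v) uv.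
Qed.

Lemma iso_nerve_lift n (A : subsset (Delta n)) (A0 : forall y : Delta n 0, smem A y)
    (u : shom A H) (v : shom (Delta n) H') :
  shom_comp q u = shom_comp v (incl A) ->
  (forall i j : 'I_n.+1, i <= j ->
     R (vtx_at (shom_comp (iso_bwd r) u) A0 i)
       (vtx_at (shom_comp (iso_bwd r) u) A0 j)) ->
  exists w : shom (Delta n) H, shom_comp w (incl A) = u /\ shom_comp q w = v.
Proof.
move=> uv nR; have [w wu] := nerve_restr_surj nR.
have wu' : shom_comp (shom_comp (iso_fwd r) w) (incl A) = u.
  apply: (iso_bwd_inj (i := r)); rewrite -wu.
  by rewrite !shom_compA iso_bwdK shom_comp_idl.
exists (shom_comp (iso_fwd r) w); split=> //.
apply: (iso_bwd_inj (i := r')); apply: (nerve_restr_inj A0).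
by rewrite -[RHS]shom_compA -uv -wu' !shom_compA.
Qed.

(** For an inner horn at l, an edge ij with 0 < i or j < n is in the horn, and
    the edge 0n is obtained by composing 0l with ln. *)
Lemma iso_nerve_inner : (forall x y z, R x y -> R y z -> R x z) -> inner_fibration q.
Proof.
move=> Rtr n l /andP[l0 ln] u v uv.
have A0 (y : Delta n 0) : smem (horn l) y by apply: horn_low_dim; lia.
apply: (@iso_nerve_lift n (horn l) A0 u v uv) => i j ij.
have edge_lo (a b : 'I_n.+1) (ab : a <= b) : b < n ->
    R (vtx_at (shom_comp (iso_bwd r) u) A0 a) (vtx_at (shom_comp (iso_bwd r) u) A0 b).
  move=> bn; apply: (@vtx_at_edge _ R n _ _ A0 a b ab); exists ord_max.
    by apply/eqP => /(congr1 (@nat_of_ord _)) /=; lia.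
  move=> k; apply/eqP => /(congr1 (@nat_of_ord _)); rewrite mk_smapE /pair_fun /=.
  by case: ifP; lia.
have edge_hi (a b : 'I_n.+1) (ab : a <= b) : 0 < a ->
    R (vtx_at (shom_comp (iso_bwd r) u) A0 a) (vtx_at (shom_comp (iso_bwd r) u) A0 b).
  move=> a0; apply: (@vtx_at_edge _ R n _ _ A0 a b ab); exists ord0.
    by apply/eqP => /(congr1 (@nat_of_ord _)) /=; lia.
  move=> k; apply/eqP => /(congr1 (@nat_of_ord _)); rewrite mk_smapE /pair_fun /=.
  by case: ifP; lia.
case: (posnP i) => [i0|]; last exact: edge_hi.
case: (ltnP j n) => jn; first exact: edge_lo.
by apply: Rtr (edge_lo i l _ _) (edge_hi l j _ _) => //; lia.
Qed.

End IsoNerve.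

Lemma lhorn_vertex n (y : Delta (1 + n.+1) 0) : smem (lhorn n) y.
Proof. exact: horn_low_dim. Qed.

(** An edge ij lies in the left outer horn as soon as some vertex other than 0, i
    and j exists, which is clear when there are at least four vertices. *)
Lemma lhorn_edge n (i j : 'I_n.+3) (ij : i <= j) :
  ~ [/\ n = 0, i = 1 :> nat & j = 2 :> nat] ->
  smem (lhorn n) (smap_pair ij : Delta n.+2 1).
Proof.
move=> not12; case: n => [|n] in i j ij not12 *; last first.
  have [|k k0 yk] := @smap_miss 1 n.+3 (smap_pair ij) [set ord0].
    by rewrite cards1.
  by exists k; rewrite ?inE // in k0 *.
have jlt := ltn_ord j; pose k := if (i == 1 :> nat) || (j == 1 :> nat) then 2 else 1.
have k3 : k < 3 by rewrite /k; case: ifP.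
exists (@Ordinal 3 k k3); first by rewrite -lt0n /= /k; case: ifP.
move=> s; apply/eqP => /(congr1 (@nat_of_ord _)); rewrite mk_smapE /pair_fun /= /k.
have i12 : ~~ ((i == 1 :> nat) && (j == 2 :> nat)).
  by apply/negP => /andP[/eqP i1 /eqP j2]; apply: not12.
move: i12 ij jlt; case: ifP => _; case: ifP => ij1; move: ij1;
  by move: (nat_of_ord i) (nat_of_ord j) => a b; lia.
Qed.

Section Degree0.
Variables (C D H H' : sset) (p : shom C D) (hp : shom H H').
Variables (r : sset_iso (h0 C) H) (r' : sset_iso (h0 D) H').
Hypotheses (C_inf : infty_category C) (D_cat : d_category 0%Z D).
Hypothesis hpE : shom_comp hp (shom_comp (iso_fwd r) (to_h0 C))
  = shom_comp (shom_comp (iso_fwd r') (to_h0 D)) p.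

Lemma h0_inner : inner_fibration hp.
Proof. by apply: iso_nerve_inner r r' _ _ => S T U; exact: iso_class_le_trans. Qed.

Lemma h0_vtx_hp (x : C 0) (s : H 0) : vtx (iso_bwd r 0 s) = cls x ->
  vtx (iso_bwd r' 0 (hp 0 s)) = cls (p 0 x).
Proof.
have vertex0 (X : sset) (z : X 0) : cls (act (vertex ord0) z) = cls z.
  by rewrite -[in RHS](act_id z); congr (cls (act _ z)); apply: smap_natP => i;
    rewrite !mk_smapE; case: i => -[].
move=> sx; have -> : s = iso_fwd r 0 (to_h0 C 0 x).
  have -> : to_h0 C 0 x = iso_bwd r 0 s.
    apply: sig_inj; apply: funext => i; rewrite [i]ord1.
    by rewrite -[RHS]/(vtx _) sx /= vertex0.
  by rewrite -[RHS]/(shom_comp (iso_fwd r) (iso_bwd r) 0 s) iso_fwdK.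
rewrite -[hp _ _]/(shom_comp hp (shom_comp (iso_fwd r) (to_h0 C)) 0 x) hpE.
rewrite -[iso_bwd _ _ _]/(shom_comp (iso_bwd r') (iso_fwd r') 0 (to_h0 D 0 (p 0 x))).
by rewrite iso_bwdK /vtx /= vertex0.
Qed.

Lemma edge_eq_vertices (f g : D 1) : src f = src g -> tgt f = tgt g -> f = g.
Proof.
move=> fg0 fg1; have [_ _ Dm] := D_cat.
apply: simplex_map_inj.
apply: Dm => //; apply: shomP => m [z [j zj]] /=.
have [||z' ->] := @face_factor m 0 z j => //; first exact: leq_ord.
rewrite !act_comp; congr act; case: j {zj} => -[|[|j]] //= _.
  by rewrite -!tgtE.
by rewrite -!srcE.
Qed.

(** Only the relation between the vertices 1 and 2 of Delta^2 is missing.  The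
    edge 02 lifts to an edge g of C with the same source as f; in D the edge 12
    comes from the given map on Delta^2, and composing p f with it gives a triangle whose third
    edge must be p g.  Lifting this triangle along the coCartesian edge f
    provides the edge 12 in C. *)
Lemma h0_cocart_lift (f : C 1) : cocart_lift p f ->
  cocart_lift hp (shom_comp (iso_fwd r) (to_h0 C) 1 f).
Proof.
move=> pf n u v uf uv; have [D_inf _ _] := D_cat.
apply: (@iso_nerve_lift _ _ _ _ _ _ r r' hp _ (lhorn n) (@lhorn_vertex n) u v uv).
move=> i j ij.
have [[n0 i1 j2]|not12] := pselect [/\ n = 0, i = 1 :> nat & j = 2 :> nat]; last first.
  apply: (@vtx_at_edge _ (@iso_class_le C) _ _ _ (@lhorn_vertex n) i j ij).
  exact: lhorn_edge.
subst n.
set P := vtx_at _ _.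
have edge := @vtx_at_edge _ (@iso_class_le C) _ _ (shom_comp (iso_bwd r) u)
  (@lhorn_vertex 0).
have Pf (k : 'I_2) (l : 'I_3) : k = l :> nat -> P l = cls (act (vertex k) f).
  move=> kl.
  have <- : vtx (act (vertex k) (to_h0 C 1 f)) = cls (act (vertex k) f) by exact: vtxE.
  have <- : iso_bwd r 1 (u 1 (edge01 0)) = to_h0 C 1 f.
    rewrite uf -[LHS]/(shom_comp (shom_comp (iso_bwd r) (iso_fwd r)) (to_h0 C) 1 f).
    by rewrite iso_bwdK.
  rewrite -!app_act; congr (vtx (iso_bwd r 0 (u 0 _))); apply: sig_inj => /=.
  by apply: smap_natP => s; rewrite smap_compE inlE !mk_smapE kl.
pose i0 : 'I_3 := ord0.
have P0 : P i0 = cls (src f) by apply: (Pf ord0).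
have P1 : P i = cls (tgt f) by apply: (Pf ord_max); rewrite i1.
have i0j : i0 <= j by [].
have P0j : iso_class_le (P i0) (P j).
  by apply: (edge _ _ i0j); apply: lhorn_edge => -[].
have [z zPj] := svalP (P j).
have Pj : P j = cls z by apply: sig_inj.
rewrite P0 Pj in P0j; move/(cls_le _ _ C_inf): P0j => [g [g0 g1]].
have Q (k : 'I_3) (x : C 0) : P k = cls x ->
    vtx (act (vertex k) (iso_bwd r' _ (v _ (smap_id 2)))) = cls (p 0 x).
  move=> Pk; rewrite -!app_act /= smap_comp_id -(h0_vtx_hp Pk).
  congr (vtx (iso_bwd r' 0 _)).
  exact: (congr1 (fun h : shom (lhorn 0) _ => h 0 (exist _ _ (lhorn_vertex _)))
                 (esym uv)).
have Dle : iso_class_le (cls (p 0 (tgt f))) (cls (p 0 z)).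
  rewrite -(Q _ _ P1) -(Q _ _ Pj) !vtxE; exact: (svalP (iso_bwd r' _ _) i j ij).
move/(cls_le _ _ D_inf): Dle => [k [k0 k1]].
have [|V [V2 V0 Vs Vt]] := @compose_edges _ (p 1 f) k D_inf.
  by rewrite k0 /tgt app_act.
have V1 : act (face 1 1) V = p 1 g.
  apply: edge_eq_vertices; first by rewrite Vs !src_nat g0.
  by rewrite Vt k1 -g1 /tgt app_act.
pose x a := if a == 1 then g else f.
have [|U UE] := @horn_glue 0 ord0 C x.
  by case=> [|[|a]] // [|[|b]] //; rewrite /x /= -!srcE g0.
have in1 := @lhorn_face 0 1 isT; have in2 := @lhorn_face 0 2 isT.
have edge2 : smap_comp (face 1 2) (smap_id 1) = smap_inl 1 0.
  by apply: smap_natP => s; have := ltn_ord s; rewrite !smapE /= /bump; lia.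
have [||W [WU pW]] := pf 0 U (simplex_map V).
- by rewrite (edge01E U in2 edge2) act_id UE.
- by apply: (@horn_ext 1 ord0) => -[|[|[|a]]] h // _ _; rewrite /= UE // /x /= ?V1 ?V2.
have Wface a (h : smem (lhorn 0) (face 1 a : Delta 2 1)) : 0 < a <= 2 ->
    act (face 1 a) (W 2 (smap_id 2)) = x a.
  by move=> /andP[a0 a2]; rewrite -shom_simplexE -(UE _ h) -?WU // -lt0n.
rewrite P1 Pj; apply/cls_le => //; exists (act (face 1 0) (W 2 (smap_id 2))).
split; last by rewrite tgtE -face_faceA // (Wface 1 in1) // -tgtE.
by rewrite srcE -face_faceA // (Wface 2 in2) // -tgtE.
Qed.

End Degree0.

(** * Degree minus one and conclusion *)
Lemma hm1_eq (C H : sset) (r : sset_iso (hm1 C) H) n (x y : H n) : x = y.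
Proof.
have E (t : H n) : t = iso_fwd r n (iso_bwd r n t).
  by rewrite -[RHS]/(shom_comp (iso_fwd r) (iso_bwd r) n t) iso_fwdK.
rewrite (E x) (E y); congr (iso_fwd r n _); apply: sig_inj; apply: smapP => i.
by rewrite [LHS]ord1 [RHS]ord1.
Qed.

(** A nonempty A forces C to be nonempty, and then every simplex of the target
    exists and is unique. *)
Lemma hm1_rlp (C D H H' : sset) (r : sset_iso (hm1 C) H) (r' : sset_iso (hm1 D) H')
    (q : shom H H') K (A : subsset K) :
  (exists n (x : K n), smem A x) -> has_rlp A q.
Proof.
move=> [m [x xA]] u v _.
have Cne : exists n, inhabited (C n).
  by have := svalP (iso_bwd r m (u m (exist _ x xA))).
pose s n : H n := iso_fwd r n (exist _ (smap_const n ord0 : Delta 0 n) Cne).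
have s_act a b (f : smap a b) (y : K b) : s a = act f (s b) by exact: hm1_eq r _ _ _.
exists (@SHom K H (fun n _ => s n) s_act); split; apply: shomP => n y.
  exact: (hm1_eq r).
exact: (hm1_eq r').
Qed.

Theorem proposition3p3 (d : int) (hd : (-1 <= d)%R) (C D : sset) (p : shom C D)
  (C_cat : infty_category C) (D_cat : d_category d D)
  (hC : hcat d C) (hD : hcat d D) (hp : shom hC hD) (hpE : is_hmap p hp) :
  inner_fibration p ->
  inner_fibration hp /\
  (forall f : C 1, cocartesian p f -> cocartesian hp (theta hC 1 f)).
Proof.
case: hC hD hp hpE => H r [H' r']; rewrite /is_hmap /theta /= => hp hpE p_inner.
case: d hd D_cat r r' hpE => [[|e]|k] _ D_cat r r' hpE.
- split=> [|f /cocart_cocart_lift pf]; first exact: h0_inner r r' C_cat.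
  exact/cocart_lift_cocart/(h0_cocart_lift C_cat D_cat hpE).
- split=> [|f /cocart_cocart_lift pf]; first exact: hrep_inner D_cat hpE p_inner.
  exact/cocart_lift_cocart/(hrep_cocart_lift C_cat D_cat hpE).
split=> [n l ln|f _].
  apply: (hm1_rlp r r'); exists 0, (vertex l); apply: horn_low_dim.
  by case/andP: ln; case: (nat_of_ord l) => // a _; lia.
apply: cocart_lift_cocart => n u v _; apply: (hm1_rlp r r').
by exists 1, (smap_inl 1 n); exact: inl_in.
Qed.
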